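(* For every loopless matroid $M$ with nonempty ground set, \[\underline{H}_M(x)=\sum_{F\in\mathcal{L}(M),\,F\neq\varnothing}\overline{\chi}_{M|_F}(x)\,\underline{H}_{M/F}(x).\] Consequently, the map $M\mapsto\underline{H}_M(x)$ on loopless matroids is the unique assignment $M\mapsto h_M(x)\in\mathbb{Z}[x]$ satisfying $h_M(x)=1$ when $\mathrm{rk}(M)=0$ and $h_M(x)=\sum_{F\neq\varnothing}\overline{\chi}_{M|_F}(x)\,h_{M/F}(x)$ otherwise.
   Context: Matroids are on finite ground sets; $\mathrm{rk}$ is the rank function; a matroid is loopless if every singleton has rank $1$. $\mathcal{L}(M)$ is the lattice of flats of $M$ (bottom $\varnothing$, top $E$ for loopless $M$ on $E$); $M|_F$ is the restriction and $M/F$ the contraction by a flat $F$. $\mu$ is the Möbius function of $\mathcal{L}(M)$. The characteristic polynomial is $\chi_M(x)=\sum_{F\in\mathcal{L}(M)}\mu(\varnothing,F)\,x^{\mathrm{rk}(M)-\mathrm{rk}(F)}$; the reduced characteristic polynomial is $\overline{\chi}_M(x)=\chi_M(x)/(x-1)$ if $E\neq\varnothing$ and $\overline{\chi}_M(x)=-1$ if $E=\varnothing$. Chow ring: for loopless $M$ on $E$, $\underline{\mathrm{CH}}(M)=\mathbb{Q}[x_F: F\in\mathcal{L}(M)\setminus\{\varnothing,E\}]/(I+J)$, where $I$ is generated by $x_{F_1}x_{F_2}$ for incomparable $F_1,F_2$, and $J$ by $\sum_{F\ni i}x_F-\sum_{F\ni j}x_F$ for $i,j\in E$; variables have degree $1$.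 The Chow polynomial is $\underline{H}_M(x)=\sum_j\dim_{\mathbb{Q}}\underline{\mathrm{CH}}^j(M)\,x^j$. *)

(* Defs.v *)
From HB Require Import structures.
From mathcomp Require Import all_boot all_order all_algebra.
From mathcomp Require Import mpoly.

Set Implicit Arguments.
Unset Strict Implicit.
Unset Printing Implicit Defensive.

Import Order.TTheory GRing.Theory Num.Theory.
Local Open Scope ring_scope.

(* Matroids.  A matroid lives inside a finite "universe" type T: it    *)
(* consists of a ground set E ⊆ T and a rank function; only the values *)
(* of the rank function on subsets of E are constrained/used.          *)
Record matroid (T : finType) := Matroid {
  ground : {set T};
  rk : {set T} -> nat }.

Section Matroids.
Variable T : finType.
Implicit Types (M : matroid T) (A B F : {set T}).

Definition is_matroid M : Prop :=
  [/\ (forall A, A \subset ground M -> (rk M A <= #|A|)%N),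
      (forall A B, A \subset B -> B \subset ground M -> (rk M A <= rk M B)%N) &
      (forall A B, A \subset ground M -> B \subset ground M ->
         (rk M (A :|: B) + rk M (A :&: B) <= rk M A + rk M B)%N)].

Definition loopless M : Prop :=
  is_matroid M /\ forall i, i \in ground M -> rk M [set i] = 1%N.

Definition rank M : nat := rk M (ground M).

Definition is_flat M F : bool :=
  (F \subset ground M) &&
  [forall x in ground M :\: F, (rk M F < rk M (x |: F))%N].

Definition flats M : {set {set T}} := [set F | is_flat M F].

Definition restrict M F : matroid T := Matroid F (rk M).
Definition contract M F : matroid T :=
  Matroid (ground M :\: F) (fun A => (rk M (A :|: F) - rk M F)%N).

Fixpoint mob_fuel M (k : nat) A B : int :=
  if A == B then 1 else
  match k with
  | 0 => 0
  | k'.+1 =>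
      if A \subset B then
        - \sum_(H in flats M | (A \subset H) && (H \proper B)) mob_fuel M k' A H
      else 0
  end.

Definition mobius M A B : int := mob_fuel M #|B| A B.

Definition charpoly M : {poly int} :=
  \sum_(F in flats M) mobius M set0 F *: 'X^(rank M - rk M F).

Definition redcharpoly M : {poly int} :=
  if ground M == set0 then -1 else charpoly M %/ ('X - 1).

(* Chow ring.  Variables x_F, F in L(M) \ {0, E}, are indexed by        *)
(* 'I_#|pflats M| via enum_val.                                        *)
Definition pflats M : {set {set T}} :=
  [set F in flats M | (F != set0) && (F != ground M)].

Definition nvar M : nat := #|pflats M|.

Definition varflat M (i : 'I_(nvar M)) : {set T} := enum_val i.

Definition lin_form M (a : T) : {mpoly rat[nvar M]} :=
  \sum_(i < nvar M | a \in varflat i) 'X_i.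

Definition incomparable_vars M (ik : 'I_(nvar M) * 'I_(nvar M)) : bool :=
  ~~ (varflat ik.1 \subset varflat ik.2) && ~~ (varflat ik.2 \subset varflat ik.1).

Local Notation mons M j := ('X_{1..(nvar M) < j.+1}).

Definition coefvec M (j : nat) (p : {mpoly rat[nvar M]}) : 'rV[rat]_#|{: mons M j}| :=
  \row_(k < #|{: mons M j}|) p@_(val (enum_val k : mons M j)).

Definition homog_gens M (j : nat) : seq {mpoly rat[nvar M]} :=
  [seq 'X_[val m] | m <- enum {: mons M j} & mdeg (val m) == j].

(* degree-j part of the (homogeneous) ideal I + J: spanned by the
   products of monomials with the generators of total degree j *)
Definition ideal_gens M (j : nat) : seq {mpoly rat[nvar M]} :=
  [seq 'X_[val m.1] * ('X_(m.2.1) * 'X_(m.2.2))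
     | m <- enum {: mons M j * ('I_(nvar M) * 'I_(nvar M))}
     & (mdeg (val m.1) + 2 == j)%N && incomparable_vars m.2]
  ++
  [seq 'X_[val m.1] * (lin_form M m.2.1 - lin_form M m.2.2)
     | m <- enum {: mons M j * (T * T)}
     & [&& (mdeg (val m.1) + 1 == j)%N, m.2.1 \in ground M & m.2.2 \in ground M]].

Definition chow_dim M (j : nat) : nat :=
  (\dim <<[seq coefvec j p | p <- homog_gens M j]>>%VS
   - \dim <<[seq coefvec j p | p <- ideal_gens M j]>>%VS)%N.

(* Chow polynomial  sum_j dim CH^j(M) x^j  (CH^j(M) = 0 for j > rk M) *)
Definition chowpoly M : {poly int} :=
  \poly_(j < (rank M).+1) (chow_dim M j)%:Z.

End Matroids.

(* Main.v *)
(** The Feichtner-Yuzvinsky presentation of the Chow ring keeps the variable x_E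
    and is generated by the relations x_F x_G for F, G incomparable and
    x_F h_G^(rk G - rk F) for F < G, where h_G is the sum of the x_H with H >= G
    and x_F is read as 1 for F empty; all the latter follow from h_A = 0 for atoms A.
    It makes sense for any up-closed set P of flats in an interval above a flat F0.
    Adding to P a new minimal flat F is a blow-up: the quotient B for P is replaced
    by B[x] modulo x J and (x + h_F)^r, where r = rk F - rk F0 and B/J is the ring of
    the interval above F.  Since J h_F^r = 0 in B and (x + h_F)^r is monic, the new
    ring is the direct sum of B and of x^k (B/J) for 0 < k < r.  Inserting all the
    flats from the top down therefore gives, for H_F the Hilbert polynomial of the
    interval above F,
      H_F = 1 + sum_(G > F) (x + ... + x^(rk G - rk F - 1)) H_G.
    Multiplying by x - 1 turns this into
      sum_(G >= F) x^(rk G - rk F) H_G = x sum_(G >= F) H_G - (x - 1),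
    and Moebius inversion of this identity is the recursion. *)
From HB Require Import structures.
From mathcomp Require Import all_boot all_order all_algebra.
From mathcomp Require Import mpoly zify.
Require Import Defs.

Set Implicit Arguments.
Unset Strict Implicit.
Unset Printing Implicit Defensive.

Import GRing.Theory.
Local Open Scope ring_scope.

(** * Ideals and supports of polynomials *)

Section Ideals.
Variable S : comNzRingType.
Implicit Types (gen : S -> Prop) (p q : S).

(** Quotient rings are never formed: congruence of p and q is expressed by [ideal gen (p - q)].
    Multiples of generators are added one at a time, so an induction on membership deals with a
    single generator. *)
Inductive ideal gen : S -> Prop :=
| ideal0 : ideal gen 0
| ideal_cons q g p : gen g -> ideal gen p -> ideal gen (q * g + p).

Lemma idealD gen p q : ideal gen p -> ideal gen q -> ideal gen (p + q).
Proof.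
by elim=> [|r g p' gg _ IH] Iq; rewrite ?add0r // -addrA; apply: ideal_cons; auto.
Qed.

Lemma idealMl gen q p : ideal gen p -> ideal gen (q * p).
Proof.
elim=> [|r g p' gg _ IH]; first by rewrite mulr0; apply: ideal0.
by rewrite mulrDr mulrA; apply: ideal_cons.
Qed.

Lemma idealMr gen q p : ideal gen p -> ideal gen (p * q).
Proof. by rewrite mulrC; apply: idealMl. Qed.

Lemma ideal_gen gen p : gen p -> ideal gen p.
Proof.
by move=> gp; rewrite -[p]mul1r -[1 * p]addr0; apply: ideal_cons (ideal0 _).
Qed.

Lemma idealN gen p : ideal gen p -> ideal gen (- p).
Proof. by rewrite -mulN1r; apply: idealMl. Qed.

Lemma idealB gen p q : ideal gen p -> ideal gen q -> ideal gen (p - q).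
Proof. by move=> Ip Iq; apply/idealD/idealN. Qed.

Lemma ideal_sum gen (I : Type) (r : seq I) (P : pred I) (f : I -> S) :
  (forall i, P i -> ideal gen (f i)) -> ideal gen (\sum_(i <- r | P i) f i).
Proof. by move=> If; apply: big_ind => //; [apply: ideal0 | apply: idealD]. Qed.

Lemma ideal_trans gen gen' p :
  (forall g, gen g -> ideal gen' g) -> ideal gen p -> ideal gen' p.
Proof.
move=> sub; elim=> [|q g p' gg _ Ip']; first exact: ideal0.
by apply: idealD => //; apply/idealMl/sub.
Qed.

Lemma ideal_congr gen p q : ideal gen (p - q) -> ideal gen q -> ideal gen p.
Proof. by move=> Ipq Iq; rewrite -[p](subrK q); apply: idealD. Qed.

Lemma ideal_congr_trans gen p q r :
  ideal gen (p - q) -> ideal gen (q - r) -> ideal gen (p - r).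
Proof. by move=> Ipq Iqr; rewrite -[p](subrK q) -addrA; apply: idealD. Qed.

Lemma ideal_congrM gen p q p' q' :
  ideal gen (p - q) -> ideal gen (p' - q') -> ideal gen (p * p' - q * q').
Proof.
move=> Ipq Ipq'; have -> : p * p' - q * q' = (p - q) * p' + q * (p' - q').
  by rewrite mulrBl mulrBr addrA subrK.
by apply: idealD; [apply: idealMr | apply: idealMl].
Qed.

End Ideals.

Lemma ideal_morph (S S' : comNzRingType) (f : {rmorphism S -> S'})
    (gen : S -> Prop) (gen' : S' -> Prop) p :
  (forall g, gen g -> ideal gen' (f g)) -> ideal gen p -> ideal gen' (f p).
Proof.
move=> sub; elim=> [|q g p' gg _ Ip']; first by rewrite rmorph0; apply: ideal0.
by rewrite rmorphD rmorphM; apply: idealD => //; apply/idealMl/sub.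
Qed.

Lemma mpoly_rmorph_ext (K : comNzRingType) (n : nat) (A : comNzRingType)
    (f g : {rmorphism {mpoly K[n]} -> A}) :
  (forall c, f c%:MP = g c%:MP) -> (forall i, f 'X_i = g 'X_i) -> f =1 g.
Proof.
move=> fgC fgX; elim/mpolyind => [|c m p _ _ IH]; first by rewrite !rmorph0.
rewrite !rmorphD IH -mul_mpolyC !rmorphM fgC; congr (_ * _ + _).
rewrite mpolyXE_id !rmorph_prod; apply: eq_bigr => i _.
by rewrite !rmorphXn fgX.
Qed.

Section SupportedIn.
Variables (K : comNzRingType) (n : nat).
Implicit Types (p q : {mpoly K[n]}) (bs : seq 'X_{1..n}).

Definition supported bs p := forall m, m \notin bs -> p@_m = 0.

Lemma supported0 bs : supported bs 0.
Proof. by move=> m _; rewrite mcoeff0. Qed.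

Lemma supportedD bs p q : supported bs p -> supported bs q -> supported bs (p + q).
Proof. by move=> sp sq m mb; rewrite mcoeffD sp ?sq ?addr0. Qed.

Lemma supportedZ bs c p : supported bs p -> supported bs (c *: p).
Proof. by move=> sp m mb; rewrite mcoeffZ sp ?mulr0. Qed.

Lemma supportedX bs m : m \in bs -> supported bs 'X_[m].
Proof. by move=> mb m' m'b; rewrite mcoeffX; case: eqP m'b => // <-; rewrite mb. Qed.

Lemma supported_sub bs bs' p : {subset bs <= bs'} -> supported bs p -> supported bs' p.
Proof. by move=> sub sp m mb; apply: sp; apply: contra mb; apply: sub. Qed.

Lemma supported_ind bs (P : {mpoly K[n]} -> Prop) :
    P 0 -> (forall p q, P p -> P q -> P (p + q)) ->
    (forall c m, m \in bs -> P (c *: 'X_[m])) ->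
  forall p, supported bs p -> P p.
Proof.
move=> P0 PD PX p sp; rewrite [p]mpolyE big_seq; apply: big_ind => // m.
rewrite mcoeff_msupp => pm; apply: PX; apply: contraT => /sp pm0.
by rewrite pm0 eqxx in pm.
Qed.

End SupportedIn.

(** * Chow rings of intervals in a graded lattice *)

(** The monomials of [bs] form a basis of the polynomial ring modulo I: the last two clauses are
    spanning and linear independence. *)
Definition ideal_basis (K : comNzRingType) (n : nat) (I : {mpoly K[n]} -> Prop)
    (bs : seq 'X_{1..n}) :=
  [/\ uniq bs, (forall p, exists2 q, supported bs q & I (p - q)) &
      (forall q, supported bs q -> I q -> q = 0)].

Section GradedLattice.
Variables (K : comNzRingType) (L : finType) (le : rel L) (join : L -> L -> L).
Variable rk : L -> nat.
Hypothesis le_refl : reflexive le.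
Hypothesis le_anti : antisymmetric le.
Hypothesis le_trans : transitive le.
Hypothesis le_joinl : forall F G, le F (join F G).
Hypothesis le_joinr : forall F G, le G (join F G).
Hypothesis join_le : forall F G H, le F H -> le G H -> le (join F G) H.
Hypothesis rk_mono : forall F G, le F G -> F != G -> (rk F < rk G)%N.
(** Semimodularity, with the meet replaced by an arbitrary common lower bound F, so that only joins
    occur. *)
Hypothesis rk_join : forall F G H, le F G -> le F H ->
  (rk (join G H) + rk F <= rk G + rk H)%N.

Local Notation S := {mpoly K[#|L|]}.
Implicit Types (F G H : L) (P : {set L}).

Definition lt F G := le F G && (F != G).
Definition above F : {set L} := [set G | lt F G].
Definition flatX F : S := 'X_(enum_rank F).
Local Notation X := flatX.
Definition flath P G : S := \sum_(H in P | le G H) X H.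
Local Notation h := flath.

Lemma lt_trans_le F G H : lt F G -> le G H -> lt F H.
Proof.
case/andP=> lFG nFG lGH; rewrite /lt (le_trans lFG lGH) /=.
by apply: contra nFG => /eqP E; rewrite E in lFG *; apply/eqP/le_anti; rewrite lFG lGH.
Qed.

Lemma lt_rk F G : lt F G -> (rk F < rk G)%N.
Proof. by case/andP; apply: rk_mono. Qed.

Lemma lt_join G H : ~~ le H G -> lt G (join G H).
Proof.
move=> nHG; rewrite /lt le_joinl /=; apply: contra nHG => /eqP E.
by rewrite E le_joinr.
Qed.

(* Relations of the Chow ring of the interval above F0, with variables in P only;
   variables outside P are kept in the polynomial ring and set to zero. *)
Inductive rels F0 P : S -> Prop :=
| rel_out G of G \notin P : rels F0 P (X G)
| rel_inc G H of ~~ le G H & ~~ le H G : rels F0 P (X G * X H)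
| rel_mul G H of lt G H & H \in P : rels F0 P (X G * h P H ^+ (rk H - rk G))
| rel_top H of H \in P : rels F0 P (h P H ^+ (rk H - rk F0)).

Lemma flath_diff P G H : le G H ->
  h P G - h P H = \sum_(K in P | le G K && ~~ le H K) X K.
Proof.
move=> lGH; rewrite /flath (bigID (fun K => le H K)) /= addrC.
rewrite [X in _ + X - _](eq_bigl (fun K => (K \in P) && le H K)).
  by rewrite addrK; apply: eq_bigl => K'; rewrite andbA.
move=> K' /=; case: (K' \in P) => //=; apply/andb_idl; exact: le_trans.
Qed.

(** The two linear forms differ by variables x_K with K above H but not above the join. Such a K is
    incomparable to G, so x_G kills the difference. Leaving [gen] arbitrary lets both presentations
    use this. *)
Lemma X_h_join (gen : S -> Prop) P G H k :
    (forall G H, ~~ le G H -> ~~ le H G -> gen (X G * X H)) -> ~~ le H G ->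
  ideal gen (X G * h P H ^+ k - X G * h P (join G H) ^+ k).
Proof.
move=> inc nHG; rewrite -mulrBr subrXX mulrA; apply: idealMr.
rewrite flath_diff // mulr_sumr; apply: ideal_sum => G' /andP[_ /andP[lHG' njG']].
apply/ideal_gen/inc.
  by apply: contra njG' => lGG'; apply: join_le.
by apply: contra nHG; apply: le_trans.
Qed.

Definition upset F0 P :=
  (forall G, G \in P -> lt F0 G) /\ (forall G H, G \in P -> le G H -> H \in P).

(** After H is replaced by the join of G and H, the bound on k makes the power a multiple of a
    relation [rel_mul]. *)
Lemma rels_X_h F0 P G H k :
    upset F0 P -> ~~ le H G -> (rk (join G H) <= rk G + k)%N ->
  ideal (rels F0 P) (X G * h P H ^+ k).
Proof.
move=> [_ upP] nHG rkJ.
have [PG|nPG] := boolP (G \in P); last exact/idealMr/ideal_gen/rel_out.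
apply: ideal_congr; first by apply: X_h_join (nHG) => *; apply: rel_inc.
have lJ := lt_join nHG.
have -> : k = (rk (join G H) - rk G + (k - (rk (join G H) - rk G)))%N by lia.
rewrite exprD mulrA; apply/idealMr/ideal_gen/rel_mul => //.
exact: upP PG (le_joinl _ _).
Qed.

(** * One blow-up: adding a new minimal flat F to an up-closed set P *)

Section BlowUp.
Variables (F0 F : L) (P : {set L}).
Hypothesis upP : upset F0 P.
Hypothesis aboveP : forall G, lt F G -> G \in P.
Hypothesis nPF : F \notin P.
Hypothesis ltF0F : lt F0 F.

Lemma nleF G : G \in P -> ~~ le G F.
Proof. by move=> PG; apply: contra nPF; case: upP => _ up /(up _ _ PG). Qed.

Lemma neqF G : G \in P -> G != F.
Proof. by move=> PG; apply: contraNneq nPF => <-. Qed.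

Lemma flath_above G : lt F G -> h (above F) G = h P G.
Proof.
move=> ltFG; apply: eq_bigl => H; rewrite inE; case lGH: (le G H); rewrite ?andbF // !andbT.
by have ltFH := lt_trans_le ltFG lGH; rewrite ltFH aboveP.
Qed.

Lemma flathU G : h (F |: P) G = (if le G F then X F else 0) + h P G.
Proof. by rewrite /flath big_mkcondr /= big_setU1 //= -big_mkcondr. Qed.

Lemma flathU_id G : ~~ le G F -> h (F |: P) G = h P G.
Proof. by move=> nGF; rewrite flathU (negbTE nGF) add0r. Qed.

Let r := (rk F - rk F0)%N.

(* This is what makes the sum of B and the x^k (B/J) direct: J h_F^r = 0 in B. *)
Lemma rels_above_mul g : ideal (rels F (above F)) g ->
  ideal (rels F0 P) (g * h P F ^+ r).
Proof.
have [gtF0 _] := upP; have leF0F : le F0 F by case/andP: ltF0F.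
elim=> [|q {}g p gg _ IH]; first by rewrite mul0r; apply: ideal0.
rewrite mulrDl -mulrA; apply: idealD => //; apply: idealMl; case: gg => {g IH}.
- move=> G; rewrite inE => nFG.
  have [PG|nPG] := boolP (G \in P); last exact/idealMr/ideal_gen/rel_out.
  have nlFG : ~~ le F G by apply: contra nFG => lFG; rewrite /lt lFG eq_sym neqF.
  apply: rels_X_h => //; have /andP[lF0G _] := gtF0 _ PG.
  have := rk_join lF0G leF0F; have := lt_rk (gtF0 _ PG); have := lt_rk ltF0F.
  by rewrite /r; lia.
- by move=> G H *; apply/idealMr/ideal_gen/rel_inc.
- move=> G H ltGH; rewrite inE => ltFH; rewrite flath_above //.
  by apply/idealMr/ideal_gen/rel_mul => //; apply: aboveP.
move=> H; rewrite inE => ltFH; rewrite flath_above // mulrC.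
have PH := aboveP ltFH; have /andP[lFH _] := ltFH.
(* Replacing h_F by h_H makes the exponents add up to rk H - rk F0, which is [rel_top]. The error
   consists of multiples of x_G h_H^(rk H - rk F) with G above F but not above H; these vanish by
   semimodularity over F. *)
apply: (@ideal_congr _ _ _ (h P H ^+ r * h P H ^+ (rk H - rk F))); last first.
  rewrite -exprD; have -> : (r + (rk H - rk F) = rk H - rk F0)%N.
    by have := lt_rk ltFH; have := lt_rk ltF0F; rewrite /r; lia.
  exact/ideal_gen/rel_top.
rewrite -mulrBl subrXX mulrAC; apply: idealMr.
rewrite flath_diff // mulr_suml; apply: ideal_sum => G /andP[PG /andP[lFG nlHG]].
apply: rels_X_h => //; move: (rk_join lFG lFH) (lt_rk ltFH); clear; lia.
Qed.

(** The ring of the interval above F is a quotient of the ring for P. The delicate relation is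
    [rel_top] at an H not above F: there h_H becomes h of the join of F and H, since variables not
    above F vanish, and semimodularity shows that the exponent is large enough. *)
Lemma rels_sub_above g : rels F0 P g -> ideal (rels F (above F)) g.
Proof.
have [gtF0 _] := upP; have leF0F : le F0 F by case/andP: ltF0F.
case=> {g}.
- move=> G nPG; apply/ideal_gen/rel_out; rewrite inE; apply: contra nPG; exact: aboveP.
- by move=> G H *; apply/ideal_gen/rel_inc.
- move=> G H ltGH PH; have [FG|nFG] := boolP (lt F G); last first.
    by apply/idealMr/ideal_gen/rel_out; rewrite inE.
  have ltFH : lt F H by apply: lt_trans_le FG _; case/andP: ltGH.
  by rewrite -flath_above //; apply/ideal_gen/rel_mul => //; rewrite inE.
move=> H PH; have [FH|nFH] := boolP (lt F H).
  rewrite -flath_above //.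
  have -> : (rk H - rk F0 = rk H - rk F + r)%N.
    by have := lt_rk FH; have := lt_rk ltF0F; rewrite /r; lia.
  by rewrite exprD; apply/idealMr/ideal_gen/rel_top; rewrite inE.
have ltFJ := lt_join (nleF PH).
apply: (@ideal_congr _ _ _ (h (above F) (join F H) ^+ (rk H - rk F0))).
  rewrite subrXX; apply: idealMr; rewrite flath_above //.
  rewrite flath_diff //; apply: ideal_sum => G /andP[PG /andP[lHG nJG]].
  apply/ideal_gen/rel_out; rewrite inE; apply: contra nJG => /andP[lFG _].
  exact: join_le.
have /andP[lF0H _] := gtF0 _ PH.
have -> : (rk H - rk F0 = rk (join F H) - rk F + (rk H - rk F0 - (rk (join F H) - rk F)))%N.
  have := rk_join leF0F lF0H; have := lt_rk ltFJ; have := lt_rk ltF0F.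
  by have := lt_rk (gtF0 _ PH); lia.
by rewrite exprD; apply/idealMr/ideal_gen/rel_top; rewrite inE.
Qed.

(* Polynomials over the whole of S in the variable x_F.  The morphism is locked
   because unification would otherwise unfold [mmap] and not terminate. *)
Definition asPoly : {rmorphism S -> {poly S}} :=
  locked (mmap (polyC \o @mpolyC _ K)
    (fun i => if i == enum_rank F then 'X else ('X_i)%:P) : {rmorphism S -> {poly S}}).
Local Notation tau := asPoly.

Lemma asPolyC c : tau c%:MP = (c%:MP)%:P.
Proof. by rewrite /asPoly -lock /= mmapC. Qed.

Lemma asPolyXi i : tau 'X_i = if i == enum_rank F then 'X else ('X_i)%:P.
Proof. by rewrite /asPoly -lock /= mmapX mmap1U. Qed.

Lemma asPolyX G : tau (X G) = if G == F then 'X else (X G)%:P.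
Proof. by rewrite asPolyXi (inj_eq enum_rank_inj). Qed.

Lemma asPolyK p : (tau p).[X F] = p.
Proof.
apply: (mpoly_rmorph_ext (f := horner_eval (X F) \o tau) (g := idfun)) => [c|i] /=.
  by rewrite /horner_eval asPolyC hornerC.
rewrite /horner_eval asPolyXi; case: eqP => [->|_]; first by rewrite hornerX.
by rewrite hornerC.
Qed.

(** The variable x_F does not occur in p: its expansion in powers of x_F is constant. *)
Definition free_of p := tau p = p%:P.

Lemma free_ofD p q : free_of p -> free_of q -> free_of (p + q).
Proof. by rewrite /free_of rmorphD => -> ->; rewrite rmorphD. Qed.

Lemma free_ofM p q : free_of p -> free_of q -> free_of (p * q).
Proof. by rewrite /free_of rmorphM => -> ->; rewrite rmorphM. Qed.

Lemma free_ofN p : free_of p -> free_of (- p).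
Proof. by rewrite /free_of rmorphN => ->; rewrite rmorphN. Qed.

Lemma free_ofXn p k : free_of p -> free_of (p ^+ k).
Proof. by rewrite /free_of rmorphXn => ->; rewrite rmorphXn. Qed.

Lemma free_ofC c : free_of c%:MP.
Proof. exact: asPolyC. Qed.

(** Applying [tau] to the coefficients of [tau p] and embedding them as constants are both ring
    morphisms in p, so they need only be compared on constants and variables. *)
Lemma free_of_coef p k : free_of (tau p)`_k.
Proof.
have /(congr1 (fun u : {poly {poly S}} => u`_k)) : map_poly tau (tau p) = map_poly polyC (tau p).
  apply: (mpoly_rmorph_ext (f := map_poly tau \o tau)
    (g := map_poly (@polyC _) \o tau)) => [c|i] /=.
    by rewrite !asPolyC !map_polyC /= asPolyC.
  rewrite !asPolyXi; case: ifP => Ei; rewrite ?map_polyX // !map_polyC /=.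
  by rewrite asPolyXi Ei.
by rewrite !coef_map.
Qed.

Lemma free_ofX (m : 'X_{1..#|L|}) : m (enum_rank F) = 0%N -> free_of 'X_[m].
Proof.
move=> mF; rewrite /free_of mpolyXE_id !rmorph_prod; apply: eq_bigr => i _.
rewrite !rmorphXn asPolyXi; case: eqP => // ->; by rewrite mF !expr0.
Qed.

Lemma free_of_h G : free_of (h P G).
Proof.
rewrite /flath; apply: big_ind => [||H /andP[PH _]]; first exact: (free_ofC 0).
  exact: free_ofD.
by rewrite /free_of asPolyX (negbTE (neqF PH)).
Qed.

Lemma free_of_supported (bs : seq 'X_{1..#|L|}) p :
  (forall m, m \in bs -> m (enum_rank F) = 0%N) -> supported bs p -> free_of p.
Proof.
move=> bF; elim/supported_ind => [||c m mb]; first exact: (free_ofC 0).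
  exact: free_ofD.
by rewrite -mul_mpolyC; apply/free_ofM/free_ofX/bF => //; apply: free_ofC.
Qed.

(** Both [rels F0 P] and [rels F (above F)] contain x_F as an outside variable, but x_F survives the
    blow-up. Memberships are therefore transported through the substitution x_F = 0, which fixes
    every polynomial free of x_F. *)
Let sigma : {rmorphism S -> S} := horner_eval 0 \o tau.

Lemma sigmaX G : sigma (X G) = if G == F then 0 else X G.
Proof. by rewrite /sigma /= /horner_eval asPolyX; case: ifP; rewrite ?hornerX ?hornerC. Qed.

Lemma sigma_free p : free_of p -> sigma p = p.
Proof. by rewrite /sigma /= /horner_eval => ->; rewrite hornerC. Qed.

Lemma sigma_hn G k : sigma (h P G ^+ k) = h P G ^+ k.
Proof. by apply/sigma_free/free_ofXn/free_of_h. Qed.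

Lemma sigma_rels p : ideal (rels F0 P) p -> ideal (rels F0 (F |: P)) (sigma p).
Proof.
apply: (ideal_morph (f := sigma)) => _ [G nPG|G H nGH nHG|G H ltGH PH|H PH].
- rewrite sigmaX; case: eqP => [_|/eqP nGF]; first exact: ideal0.
  by apply/ideal_gen/rel_out; rewrite !inE negb_or nGF.
- rewrite rmorphM !sigmaX; case: eqP => _; first by rewrite mul0r; apply: ideal0.
  case: eqP => _; first by rewrite mulr0; apply: ideal0.
  exact/ideal_gen/rel_inc.
- rewrite rmorphM sigmaX sigma_hn; case: eqP => _; first by rewrite mul0r; apply: ideal0.
  rewrite -flathU_id ?nleF //; apply/ideal_gen/rel_mul => //.
  by rewrite !inE PH orbT.
rewrite sigma_hn -flathU_id ?nleF //; apply/ideal_gen/rel_top.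
by rewrite !inE PH orbT.
Qed.

(** This is x_F J = 0 in the new ring. A variable x_G with G neither F nor above F is killed because
    G is incomparable to F, or lies below F and hence outside the enlarged set; [rel_top] for the
    interval above F turns into [rel_mul] with first flat F. *)
Lemma sigma_above p : ideal (rels F (above F)) p ->
  ideal (rels F0 (F |: P)) (X F * sigma p).
Proof.
elim=> [|q g {}p gg _ IH]; first by rewrite rmorph0 mulr0; apply: ideal0.
rewrite rmorphD rmorphM mulrDr mulrCA; apply: idealD => //; apply: idealMl.
case: gg => {g IH}.
- move=> G; rewrite inE => nFG; rewrite sigmaX; case: eqP => [_|/eqP nGF].
    by rewrite mulr0; apply: ideal0.
  have nlFG : ~~ le F G by apply: contra nFG => lFG; rewrite /lt lFG eq_sym.
  have [lGF|nlGF] := boolP (le G F); last exact/ideal_gen/rel_inc.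
  apply/idealMl/ideal_gen/rel_out; rewrite !inE negb_or nGF.
  by apply: contraL lGF; apply: nleF.
- move=> G H nGH nHG; rewrite rmorphM !sigmaX.
  case: eqP => _; first by rewrite mul0r mulr0; apply: ideal0.
  case: eqP => _; first by rewrite !mulr0; apply: ideal0.
  exact/idealMl/ideal_gen/rel_inc.
- move=> G H ltGH; rewrite inE => ltFH; have PH := aboveP ltFH.
  rewrite flath_above // rmorphM sigmaX sigma_hn.
  case: eqP => _; first by rewrite mul0r mulr0; apply: ideal0.
  rewrite -flathU_id ?nleF //; apply/idealMl/ideal_gen/rel_mul => //.
  by rewrite !inE PH orbT.
move=> H; rewrite inE => ltFH; have PH := aboveP ltFH.
rewrite flath_above // sigma_hn -flathU_id ?nleF //.
by apply/ideal_gen/rel_mul => //; rewrite !inE PH orbT.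
Qed.

Variables (b c : seq 'X_{1..#|L|}).
Hypothesis basis_b : ideal_basis (ideal (rels F0 P)) b.
Hypothesis basis_c : ideal_basis (ideal (rels F (above F))) c.
Hypothesis free_b : forall m : 'X_{1..#|L|}, m \in b -> m (enum_rank F) = 0%N.
Hypothesis free_c : forall m : 'X_{1..#|L|}, m \in c -> m (enum_rank F) = 0%N.

Definition blowup_basis : seq 'X_{1..#|L|} :=
  b ++ [seq (U_(enum_rank F) *+ k + m)%MM | k <- iota 1 r.-1, m <- c].
Local Notation bc := blowup_basis.

Lemma blowup_basisP m : reflect
  (m \in b \/ exists k m', [/\ (0 < k < r)%N, m' \in c &
     m = (U_(enum_rank F) *+ k + m')%MM])
  (m \in bc).
Proof.
have r0 : (0 < r)%N by rewrite subn_gt0 lt_rk.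
rewrite mem_cat; apply: (iffP orP) => -[mb|H]; [by left| |by left|].
  right; have /allpairsP[[k m'] /= [kr mc ->]] := H.
  by exists k, m'; split=> //; move: kr; rewrite mem_iota; lia.
right; have [k [m' [kr mc ->]]] := H; apply/allpairsP; exists (k, m'); split=> //=.
by rewrite mem_iota; lia.
Qed.

(** Monomials of b and c are free of x_F, so the exponent of x_F recovers k, with k = 0 exactly on
    b. *)
Lemma blowup_uniq : uniq bc.
Proof.
have [ub _ _] := basis_b; have [uc _ _] := basis_c.
have degF k m : m \in c -> (U_(enum_rank F) *+ k + m)%MM (enum_rank F) = k.
  by move=> mc; rewrite mnmDE mulmnE mnm1E eqxx mul1n free_c ?addn0.
rewrite cat_uniq ub /= allpairs_uniq ?iota_uniq ?andbT //.
  apply/hasPn => _ /allpairsP[[k m] /= [kr mc ->]]; apply: contraL kr => /free_b.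
  by rewrite degF // => ->; rewrite mem_iota.
move=> _ _ /allpairsP[[k m] /= [_ mc ->]] /allpairsP[[k' m'] /= [_ mc' ->]] E.
have Ek : k = k' by rewrite -(degF k m mc) E degF.
by rewrite Ek in E *; rewrite (addmI E).
Qed.

Let I' := ideal (rels F0 (F |: P)).
Definition reducible p := exists2 q, supported bc q & I' (p - q).

Lemma reducibleD p q : reducible p -> reducible q -> reducible (p + q).
Proof.
case=> p' sp Ip [q' sq Iq]; exists (p' + q'); first exact: supportedD.
by rewrite opprD addrACA; apply: idealD.
Qed.

Lemma reducible0 : reducible 0.
Proof. by exists 0; [apply: supported0 | rewrite subrr; apply: ideal0]. Qed.

Lemma reducible_congr p q : I' (p - q) -> reducible q -> reducible p.
Proof. by move=> Ipq [q' sq Iq]; exists q' => //; apply: ideal_congr_trans Iq. Qed.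

Lemma reducible_sum (I : Type) (s : seq I) (Q : pred I) (f : I -> S) :
  (forall i, Q i -> reducible (f i)) -> reducible (\sum_(i <- s | Q i) f i).
Proof.
move=> Hf; apply: big_ind => //; [exact: reducible0|exact: reducibleD].
Qed.

(** Strong induction on k. For k = 0 the coefficient is reduced by b; for 0 < k < r it is reduced by
    c, since x_F J = 0; for k at least r the monic relation (x_F + h_F)^r lowers the power. *)
Lemma reducible_free k p : free_of p -> reducible (X F ^+ k * p).
Proof.
have [_ span_b _] := basis_b; have [_ span_c _] := basis_c.
have r0 : (0 < r)%N by rewrite subn_gt0 lt_rk.
have rP : I' ((X F + h P F) ^+ r).
  have := @rel_top F0 (F |: P) F; rewrite flathU le_refl => /(_ (setU11 _ _)).
  exact: ideal_gen.
elim/ltn_ind: k p => -[_|k IH] p fp.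
  rewrite mul1r; have [q sq Iq] := span_b p; exists q.
    by apply: supported_sub sq => m mb; rewrite mem_cat mb.
  have fq := free_of_supported free_b sq.
  have <- : sigma (p - q) = p - q by apply/sigma_free/free_ofD/free_ofN.
  exact: sigma_rels.
have [kr|rle] := ltnP k.+1 r.
  have [q sq Iq] := span_c p; exists (X F ^+ k.+1 * q).
    elim/supported_ind: sq => [|u v su sv|a m mc].
    - by rewrite mulr0; apply: supported0.
    - by rewrite mulrDr; apply: supportedD.
    rewrite -scalerAr; apply: supportedZ; rewrite /flatX mpolyXn -mpolyXD.
    by apply/supportedX/blowup_basisP; right; exists k.+1, m.
  rewrite -mulrBr exprSr -mulrA; apply: idealMl.
  have fq := free_of_supported free_c sq.
  have <- : sigma (p - q) = p - q by apply/sigma_free/free_ofD/free_ofN.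
  exact: sigma_above.
(* The terms [f i] are the negatives of the non-leading terms of (x_F + h_F)^r x_F^(k + 1 - r) p in
   the binomial expansion. *)
pose f (i : 'I_r) := X F ^+ (k - i) * (- (h P F ^+ i.+1 * p *+ 'C(r, i.+1))).
apply: (@reducible_congr _ (\sum_i f i)).
  have -> : X F ^+ k.+1 * p - \sum_i f i = (X F + h P F) ^+ r * (X F ^+ (k.+1 - r) * p).
    rewrite exprDn big_ord_recl /= subn0 expr0 mulr1 bin0 mulr1n mulrDl.
    rewrite mulrA -exprD subnKC //; congr (_ + _); rewrite -sumrN mulr_suml.
    apply: eq_bigr => i _; rewrite /f mulrN opprK /bump leq0n add1n.
    have -> : (k - i = (r - i.+1) + (k.+1 - r))%N by case: i => /= i; lia.
    by rewrite exprD !(mulrnAl, mulrnAr) mulrACA.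
  exact: idealMr.
apply: reducible_sum => i _; apply: IH; first by lia.
apply/free_ofN; rewrite -mulr_natl.
apply: free_ofM; first by rewrite -mpolyC_nat; apply: free_ofC.
by apply: free_ofM => //; apply/free_ofXn/free_of_h.
Qed.

Lemma blowup_span p : reducible p.
Proof.
rewrite -[p]asPolyK horner_coef; apply: reducible_sum => i _.
by rewrite mulrC; apply/reducible_free/free_of_coef.
Qed.

Let center : {poly S} := ('X + (h P F)%:P) ^+ r.

(* The ideal of S[x] generated by I_P, x J and (x + h_F)^r. *)
Definition blowup_ideal (Q : {poly S}) := exists g : {poly S},
  ideal (rels F0 P) (Q - g * center)`_0 /\
  forall k, ideal (rels F (above F)) (Q - g * center)`_k.

Lemma blowup_idealD Q Q' : blowup_ideal Q -> blowup_ideal Q' -> blowup_ideal (Q + Q').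
Proof.
move=> [g [g0 gk]] [g' [g0' gk']]; exists (g + g').
by rewrite mulrDl opprD addrACA; split=> [|k]; rewrite coefD; apply: idealD.
Qed.

Lemma blowup_idealM A Q : blowup_ideal Q -> blowup_ideal (A * Q).
Proof.
move=> [g [g0 gk]]; exists (A * g); rewrite -mulrA -mulrBr; split=> [|k].
  by rewrite coef0M; apply: idealMl.
by rewrite coefM; apply: ideal_sum => i _; apply: idealMl.
Qed.

Lemma blowup_idealC a : ideal (rels F0 P) a -> blowup_ideal a%:P.
Proof.
move=> Ia; exists 0; rewrite mul0r subr0; split=> [|k]; rewrite coefC ?eqxx //.
case: ifP => _; last exact: ideal0.
exact: ideal_trans rels_sub_above Ia.
Qed.

Lemma blowup_idealCX a : ideal (rels F (above F)) a -> blowup_ideal (a%:P * 'X).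
Proof.
move=> Ia; exists 0; rewrite mul0r subr0; split=> [|k]; rewrite coefMX ?eqxx //=.
  exact: ideal0.
by rewrite coefC; do 2?case: ifP => _ //; apply: ideal0.
Qed.

(** Bounds the new relations from above, for linear independence. Products x_G x_F with G
    incomparable to F, and [rel_mul] starting at F, fall into x J; [rel_top] at F is the monic
    generator itself. *)
Lemma blowup_ideal_tau p : I' p -> blowup_ideal (tau p).
Proof.
elim=> [|q g {}p gg _ IH].
  by rewrite rmorph0 -polyC0; apply/blowup_idealC/ideal0.
rewrite rmorphD rmorphM; apply: blowup_idealD => //; apply: blowup_idealM.
have tauh H : ~~ le H F -> tau (h (F |: P) H) = (h P H)%:P.
  by move=> nHF; rewrite flathU_id //; apply: free_of_h.
case: gg => {q g p IH}.
- move=> G; rewrite !inE negb_or => /andP[nGF nPG]; rewrite asPolyX (negbTE nGF).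
  exact/blowup_idealC/ideal_gen/rel_out.
- have XF G : ~~ le G F -> ~~ le F G -> blowup_ideal ((X G)%:P * 'X).
    move=> _ nFG; apply/blowup_idealCX/ideal_gen/rel_out.
    by rewrite inE; apply: contra nFG => /andP[].
  move=> G H nGH nHG; rewrite rmorphM !asPolyX.
  case: eqP nGH nHG => [->|_]; case: eqP => [->|_] nGH nHG.
  + by rewrite le_refl in nGH.
  + by rewrite mulrC; apply: XF.
  + exact: XF.
  by rewrite -polyCM; apply/blowup_idealC/ideal_gen/rel_inc.
- move=> G H ltGH; rewrite !inE => /predU1P[EH|PH].
    (* A flat G below F is outside P, so x_G is already a relation. *)
    subst H; rewrite rmorphM asPolyX (negbTE (proj2 (andP ltGH))) mulrC.
    apply/blowup_idealM/blowup_idealC/ideal_gen/rel_out.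
    by apply: contraL (proj1 (andP ltGH)) => /nleF.
  rewrite rmorphM rmorphXn tauh ?nleF // asPolyX -polyC_exp; case: eqP ltGH => [->|_] ltGH.
    rewrite mulrC; apply/blowup_idealCX/ideal_gen; rewrite -flath_above //.
    by apply/rel_top; rewrite inE.
  by rewrite -polyCM; apply/blowup_idealC/ideal_gen/rel_mul.
move=> H; rewrite !inE => /predU1P[->|PH]; last first.
  rewrite rmorphXn tauh ?nleF // -polyC_exp.
  exact/blowup_idealC/ideal_gen/rel_top.
rewrite flathU le_refl rmorphXn rmorphD asPolyX eqxx free_of_h.
exists 1; rewrite mul1r subrr; split=> [|k]; rewrite coef0; exact: ideal0.
Qed.

(** Reads off the components of q in the direct sum of B and the x^k (B/J) as coefficients in
    x_F. *)
Lemma tau_supported q : supported bc q ->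
  [/\ supported b (tau q)`_0, (forall k, (0 < k)%N -> supported c (tau q)`_k) &
      (forall k, (r <= k)%N -> (tau q)`_k = 0)].
Proof.
have r0 : (0 < r)%N by rewrite subn_gt0 lt_rk.
elim/supported_ind => [|u v [u0 uk ur] [v0 vk vr]|a m /blowup_basisP mb].
- by rewrite rmorph0; split=> [|k _|k _]; rewrite coef0 //; apply: supported0.
- rewrite rmorphD; split=> [|k k0|k kr]; rewrite coefD.
  + exact: supportedD.
  + by apply: supportedD; [apply: uk | apply: vk].
  by rewrite (ur _ kr) (vr _ kr) addr0.
rewrite -mul_mpolyC rmorphM asPolyC.
case: mb => [mb|[l [m' [lr mc ->]]]].
  rewrite (free_ofX (free_b mb)) -polyCM mul_mpolyC.
  split=> [|k k0|k kr]; rewrite coefC ?eqxx.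
  - exact/supportedZ/supportedX.
  - by rewrite (gtn_eqF k0); apply: supported0.
  by rewrite gtn_eqF // (leq_trans r0 kr).
rewrite mpolyXD -mpolyXn rmorphM rmorphXn asPolyXi eqxx (free_ofX (free_c mc)).
rewrite mulrCA -polyCM mul_mpolyC mulrC.
split=> [|k k0|k kr]; rewrite coefCM coefXn.
- by rewrite ltn_eqF ?mulr0; [apply: supported0 | case/andP: lr].
- by case: eqP => _; rewrite ?mulr0 ?mulr1; [apply/supportedZ/supportedX | apply: supported0].
by rewrite gtn_eqF ?mulr0 //; case/andP: lr => _ /leq_trans; apply.
Qed.

(** Modulo J, a nonzero multiple of a monic polynomial of degree r has degree at least r. The
    coefficients of g are treated from the top down. *)
Lemma center_monic_ideal g :
    (forall k, (r <= k)%N -> ideal (rels F (above F)) (g * center)`_k) ->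
  forall k, ideal (rels F (above F)) g`_k.
Proof.
have mon : center \is monic by rewrite monic_exp // monicXaddC.
have szc : size center = r.+1.
  by have := size_exp_XsubC r (- h P F); rewrite polyCN opprK.
move=> gk k; have [n] := ubnP (size g - k); elim: n k => // n IH k kn.
have [gk0|gk0] := leqP (size g) k; first by rewrite nth_default //; apply: ideal0.
have := gk (k + r)%N (leq_addl _ _).
(* The coefficient of degree k + r is g_k plus terms in g_i: those with i > k lie in J by induction,
   and those with i < k meet a coefficient of [center] beyond its degree. *)
rewrite coefM (bigD1 (inord k)) //= inordK ?ltnS ?leq_addr // addKn.
have -> : center`_r = 1 by rewrite -(monicP mon) lead_coefE szc.
rewrite mulr1; set s := \sum_(i < _ | _) _ => Ik; rewrite -[g`_k](addrK s).
apply: idealB => //; apply: ideal_sum => i ik; case: (ltngtP i k) => [lik|lki|eik].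
- by rewrite [center`_ _]nth_default ?mulr0 ?szc; [apply: ideal0 | lia].
- by apply/idealMr/IH; lia.
by case/eqP: ik; apply: val_inj; rewrite /= inordK ?eik // ltnS leq_addr.
Qed.

(** Write [tau q] as g times [center] modulo I_P and x J. The degree of [tau q] is below r, so g has
    coefficients in J, and then so has [tau q]: its positive coefficients vanish by independence of
    c. The constant one is g_0 h_F^r modulo I_P, which lies in I_P by [rels_above_mul], and vanishes
    by independence of b. *)
Lemma blowup_free q : supported bc q -> I' q -> q = 0.
Proof.
have [_ _ ind_b] := basis_b; have [_ _ ind_c] := basis_c.
move=> /tau_supported[q0 qk qr] /blowup_ideal_tau[g [g0 gk]].
have Jg : forall k, ideal (rels F (above F)) g`_k.
  apply: center_monic_ideal => k kr; have := gk k.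
  by rewrite coefB qr // sub0r => /idealN; rewrite opprK.
have Jq k : ideal (rels F (above F)) (tau q)`_k.
  have := gk k; rewrite coefB => /ideal_congr; apply.
  by rewrite coefM; apply: ideal_sum => i _; apply: idealMr.
suff tq0 : tau q = 0 by rewrite -[q]asPolyK tq0 horner0.
apply/polyP => -[|k]; rewrite coef0; last exact: ind_c (qk _ _) (Jq _).
apply: ind_b q0 _; move: g0; rewrite coefB => /ideal_congr; apply.
rewrite coef0M -[center`_0]horner_coef0 /center horner_exp hornerD hornerX hornerC add0r.
exact: rels_above_mul (Jg 0%N).
Qed.

Lemma blowup_ideal_basis : ideal_basis I' bc.
Proof. by split; [apply: blowup_uniq | apply: blowup_span | apply: blowup_free]. Qed.

End BlowUp.

(** All variables are zero and no relation has a constant term, so the quotient is K. *)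
Lemma ideal_basis_set0 F0 : ideal_basis (ideal (rels F0 set0)) [:: 0%MM].
Proof.
split=> // [p|q sq Iq].
  exists (p@_0%MM)%:MP.
    by move=> m; rewrite inE => m0; rewrite mcoeffC (negbTE m0) mulr0.
  elim/mpolyind: p => [|c m p _ _ IH]; first by rewrite mcoeff0 subrr; apply: ideal0.
  rewrite mcoeffD mpolyCD opprD addrACA; apply: idealD => //.
  rewrite mcoeffZ mcoeffX; have [->|m0] := eqVneq m 0%MM.
    by rewrite mulr1 mpolyX0 alg_mpolyC subrr; apply: ideal0.
  rewrite mulr0 subr0 -mul_mpolyC; apply: idealMl.
  have [i mi] : exists i, m i != 0%N.
    apply/existsP; apply: contraNT m0 => /existsPn H; apply/eqP/mnmP => i.
    by rewrite mnm0E; apply/eqP; have := H i; rewrite negbK.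
  rewrite -[m](submK (m := U_(i))) ?lep1mP // mpolyXD; apply/idealMl/ideal_gen.
  by rewrite -[i]enum_valK; apply: rel_out; rewrite inE.
have q0 : q@_0%MM = 0.
  elim: Iq => [|r g p gg _ IH]; first by rewrite mcoeff0.
  rewrite mcoeffD IH addr0 rmorphM; case: gg => [G _|G H _ _|G H _|H]; rewrite ?inE //.
    by rewrite /= mcoeffX -mdeg_eq0 mdeg1 mulr0.
  by rewrite rmorphM /= !mcoeffX -mdeg_eq0 mdeg1 mul0r mulr0.
apply/mpolyP => m; rewrite mcoeff0; have [->//|m0] := eqVneq m 0%MM.
by apply: sq; rewrite inE.
Qed.

Lemma ltxx F : lt F F = false.
Proof. by rewrite /lt eqxx andbF. Qed.

Lemma lt_trans G F H : lt F G -> lt G H -> lt F H.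
Proof. by move=> FG /andP[GH _]; apply: lt_trans_le GH. Qed.

Lemma upset_above F : upset F (above F).
Proof.
split=> [G|G H]; rewrite inE //.
by move=> FG GH; rewrite inE; apply: lt_trans_le GH.
Qed.

Definition truncated_geometric (n : nat) : {poly int} := \sum_(1 <= k < n) 'X^k.

(** The second clause confines the basis monomials to the variables of P. It is carried along
    because a blow-up needs bases free of the new variable. *)
Definition has_hilbert (I : S -> Prop) P (f : {poly int}) :=
  exists bs : seq 'X_{1..#|L|},
  [/\ ideal_basis I bs, (forall m G, m \in bs -> G \notin P -> m (enum_rank G) = 0%N) &
      f = \sum_(m <- bs) 'X^(mdeg m)].

(** Induction on the size of P: a flat F of least rank in P is minimal, so removing it leaves an
    up-closed set from which P arises by one blow-up. *)
Lemma has_hilbert_upset (N : L -> {poly int}) F0 :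
    (forall F, lt F0 F -> has_hilbert (ideal (rels F (above F))) (above F) (N F)) ->
  forall P, upset F0 P ->
  has_hilbert (ideal (rels F0 P)) P
    (1 + \sum_(G in P) truncated_geometric (rk G - rk F0) * N G).
Proof.
move=> HN P; have [n] := ubnP #|P|; elim: n P => // n IH P Pn upP.
have [->|/set0Pn[G0 PG0]] := eqVneq P set0.
  exists [:: 0%MM]; split; first exact: ideal_basis_set0.
    by move=> m G; rewrite inE => /eqP -> _; rewrite mnm0E.
  by rewrite big_set0 big_seq1 mdeg0 addr0.
pose F := [arg min_(F < G0 in P) rk F].
have [PF minF] : F \in P /\ forall G, G \in P -> (rk F <= rk G)%N.
  by rewrite /F; case: arg_minnP.
have [gtF0 up] := upP; have ltF0F := gtF0 _ PF.
have nltF G : G \in P -> ~~ lt G F.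
  by move=> /minF; rewrite leqNgt; apply: contra => /lt_rk.
have upP' : upset F0 (P :\ F).
  split=> [G|G H]; rewrite !inE => /andP[nGF PG]; first exact: gtF0.
  move=> GH; rewrite (up _ _ PG GH) andbT; apply: contraTneq GH => ->.
  by move: (nltF _ PG); rewrite /lt nGF andbT.
have aboveP G : lt F G -> G \in P :\ F.
  by move=> /andP[FG nFG]; rewrite !inE eq_sym nFG; apply: up PF FG.
have nPF : F \notin P :\ F by rewrite !inE eqxx.
have [b [bb bP bN]] : has_hilbert (ideal (rels F0 (P :\ F))) (P :\ F)
    (1 + \sum_(G in P :\ F) truncated_geometric (rk G - rk F0) * N G).
  by apply: IH => //; move: Pn; rewrite (cardsD1 F) PF.
have [c [cb cP cN]] := HN _ ltF0F.
have bF (m : 'X_{1..#|L|}) : m \in b -> m (enum_rank F) = 0%N by move=> mb; apply: bP nPF.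
have cF (m : 'X_{1..#|L|}) : m \in c -> m (enum_rank F) = 0%N.
  by move=> mc; apply: cP => //; rewrite inE ltxx.
have := blowup_ideal_basis upP' aboveP nPF ltF0F bb cb bF cF; rewrite setD1K // => bcb.
exists (blowup_basis F0 F b c); split=> //.
  move=> m G; rewrite mem_cat => /orP[mb|/allpairsP[[k m'] /= [_ mc ->]]] nPG.
    by apply: bP mb _; apply: contra nPG => /setD1P[].
  rewrite mnmDE (cP _ _ mc) ?mulmnE ?mnm1E ?addn0.
    by rewrite (inj_eq enum_rank_inj) (negbTE (memPn nPG _ PF)).
  by apply: contra nPG; rewrite inE => /aboveP /setD1P[].
rewrite big_cat /= -bN (big_setD1 F) //= addrCA [RHS]addrC; congr (_ + _).
rewrite cN /truncated_geometric /index_iota subn1 big_allpairs_dep /= mulr_suml.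
apply: eq_bigr => k _; rewrite mulr_sumr; apply: eq_bigr => m _.
by rewrite mdegD mdegMn mdeg1 mul1n exprD.
Qed.

Lemma has_hilbert_above (N : L -> {poly int}) :
    (forall F, N F = 1 + \sum_(G in above F) truncated_geometric (rk G - rk F) * N G) ->
  forall F, has_hilbert (ideal (rels F (above F))) (above F) (N F).
Proof.
move=> recN F; have [n] := ubnP #|above F|; elim: n F => // n IH F Fn.
rewrite recN; apply: has_hilbert_upset (upset_above F) => G FG; apply: IH.
apply: leq_trans (_ : #|above F| <= n)%N => //; apply: proper_card.
apply/properP; split; last by exists G; rewrite inE ?ltxx.
by apply/subsetP => H; rewrite !inE; apply: lt_trans.
Qed.

(** * Reduction of the relations to the linear ones at atoms *)

Section Atoms.
Variables (bot : L) (atom : pred L).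
Hypothesis bot_le : forall F, le bot F.
Hypothesis rk_atom : forall A, atom A -> rk A = (rk bot).+1.
Hypothesis atom_sep : forall F G, lt F G -> exists A, [/\ atom A, le A G & ~~ le A F].

(* The presentation of the Chow ring with the variable of the top element. *)
Inductive atom_rels : S -> Prop :=
| arel_bot : atom_rels (X bot)
| arel_inc G H of ~~ le G H & ~~ le H G : atom_rels (X G * X H)
| arel_atom A of atom A : atom_rels (h (above bot) A).

Lemma above_bot G : (G \in above bot) = (G != bot).
Proof. by rewrite inE /lt bot_le eq_sym. Qed.

Lemma atom_rels_sub g : atom_rels g -> ideal (rels bot (above bot)) g.
Proof.
case=> [|G H nGH nHG|A aA]; apply: ideal_gen.
- by apply: rel_out; rewrite above_bot eqxx.
- exact: rel_inc.
rewrite -[h _ _]expr1 -(_ : rk A - rk bot = 1)%N; last by rewrite rk_atom //; lia.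
by apply: rel_top; rewrite above_bot; apply: contraTneq aA => ->; apply/negP => /rk_atom; lia.
Qed.

(** Induction on rk H - rk G. An atom A below H but not below G gives J, the join of G and A, of
    rank rk G + 1, and x_G h_J is congruent to x_G h_A, hence zero. Reading x_G as 1 at the bottom
    treats [rel_top] at the same time. *)
Lemma atom_rels_mul G H : lt G H ->
  ideal atom_rels ((if G == bot then 1 else X G) * h (above bot) H ^+ (rk H - rk G)).
Proof.
have [n] := ubnP (rk H - rk G); elim: n G H => // n IH G H Hn ltGH.
have [A [aA AH nAG]] := atom_sep ltGH.
have GJ := lt_join nAG; set J := join G A in GJ.
have JH : le J H by apply: join_le => //; case/andP: ltGH.
have rkJ : rk J = (rk G).+1.
  have := rk_join (bot_le G) (bot_le A); rewrite (rk_atom aA) -/J.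
  by have := lt_rk GJ; lia.
set Y := if _ then _ else _.
have IJ : ideal atom_rels (Y * h (above bot) J).
  rewrite /Y; case: eqP => [E|_].
    have -> : J = A by apply: le_anti; rewrite le_joinr join_le //= E bot_le.
    by rewrite mul1r; apply/ideal_gen/arel_atom.
  apply: (@ideal_congr _ _ _ (X G * h (above bot) A)); last first.
    exact/idealMl/ideal_gen/arel_atom.
  rewrite -opprB; apply: idealN; have := @X_h_join atom_rels (above bot) G A 1.
  by rewrite !expr1; apply=> //; apply: arel_inc.
have [<-|nJH] := eqVneq J H; first by rewrite rkJ subSnn expr1.
have ltJH : lt J H by rewrite /lt JH.
have -> : (rk H - rk G = (rk H - rk J).+1)%N.
  by move: (lt_rk ltJH); rewrite rkJ; clear; lia.
rewrite exprS mulrA.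
(* One factor h_H is replaced by h_J. The error involves x_G' with G' above J but not above H; there
   h_H may be replaced by h of the join of G' and H, and semimodularity over J puts this pair within
   the induction hypothesis. *)
apply: (@ideal_congr _ _ _ (Y * h (above bot) J * h (above bot) H ^+ (rk H - rk J))); last first.
  exact: idealMr.
rewrite -mulrBl -mulrBr -opprB mulrN mulNr; apply: idealN; rewrite -mulrA; apply: idealMl.
rewrite flath_diff // mulr_suml; apply: ideal_sum => G' /andP[]; rewrite above_bot => nG'.
case/andP=> JG' nHG'.
apply: ideal_congr; first by apply: X_h_join (nHG') => *; apply: arel_inc.
have ltG' := lt_join nHG'.
have rkH : (rk H - rk J < n)%N.
  by move: Hn (lt_rk ltJH); rewrite rkJ; clear; lia.
have rkG' : (rk (join G' H) - rk G' <= rk H - rk J)%N.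
  by move: (rk_join JG' JH) (lt_rk ltG') (lt_rk ltJH); clear; lia.
rewrite -(subnKC rkG') exprD mulrA; apply: idealMr.
by have := IH G' (join G' H) (leq_ltn_trans rkG' rkH) ltG'; rewrite (negbTE nG').
Qed.

Lemma rels_sub_atom g : rels bot (above bot) g -> ideal atom_rels g.
Proof.
case=> [G|G H nGH nHG|G H ltGH _|H].
- by rewrite above_bot negbK => /eqP ->; apply/ideal_gen/arel_bot.
- exact/ideal_gen/arel_inc.
- have := atom_rels_mul ltGH; case: eqP => // -> _.
  exact/idealMr/ideal_gen/arel_bot.
by rewrite inE => /atom_rels_mul; rewrite eqxx mul1r.
Qed.

Theorem atom_rels_hilbert (N : L -> {poly int}) :
    (forall F, N F = 1 + \sum_(G in above F) truncated_geometric (rk G - rk F) * N G) ->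
  exists2 bs, ideal_basis (ideal atom_rels) bs & N bot = \sum_(m <- bs) 'X^(mdeg m).
Proof.
move=> recN; have [bs [[ub sb fb] _ E]] := has_hilbert_above recN bot.
exists bs => //; split=> // [p|q sq Iq].
  by have [q sq Iq] := sb p; exists q => //; apply: ideal_trans Iq; apply: rels_sub_atom.
by apply: fb => //; apply: ideal_trans Iq; apply: atom_rels_sub.
Qed.

End Atoms.

End GradedLattice.

(** * The lattice of flats *)

Section Flats.
Variables (T : finType) (M : matroid T).
Hypothesis HM : is_matroid M.
Local Notation E := (ground M).
Local Notation rk := (rk M).
Implicit Types (A B F G : {set T}).

Lemma rk0 : rk set0 = 0%N.
Proof.
by case: HM => le_card _ _; apply/eqP; rewrite -leqn0 -(cards0 T) le_card ?sub0set.
Qed.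

Lemma rkS A B : A \subset B -> B \subset E -> (rk A <= rk B)%N.
Proof. by case: HM => _ mono _; apply: mono. Qed.

Lemma rk_submod A B : A \subset E -> B \subset E ->
  (rk (A :|: B) + rk (A :&: B) <= rk A + rk B)%N.
Proof. by case: HM => _ _; apply. Qed.

Lemma is_flatP F : reflect
  (F \subset E /\ forall x, x \in E -> x \notin F -> (rk F < rk (x |: F))%N)
  (is_flat M F).
Proof.
apply: (iffP andP) => -[FE /= H]; split=> //.
  by move=> x xE xF; move/forall_inP: H => /(_ x); rewrite inE xE xF => /(_ isT).
by apply/forall_inP => x; rewrite inE => /andP[xF xE]; apply: H.
Qed.

Lemma flat_sub F : is_flat M F -> F \subset E.
Proof. by case/is_flatP. Qed.

Lemma flat_ground : is_flat M E.
Proof. by apply/is_flatP; split=> // x xE; rewrite xE. Qed.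

Lemma flat_rk_lt F B : is_flat M F -> F \proper B -> B \subset E -> (rk F < rk B)%N.
Proof.
move=> /is_flatP[_ flF] /properP[FB [x xB xF]] BE.
apply: leq_trans (flF _ (subsetP BE _ xB) xF) _.
by apply: rkS => //; rewrite subUset sub1set xB.
Qed.

Definition closure A : {set T} := [set x in E | rk (x |: A) == rk A].

Lemma closure_sub A : closure A \subset E.
Proof. by apply/subsetP => x; rewrite inE => /andP[]. Qed.

Lemma sub_closure A : A \subset E -> A \subset closure A.
Proof.
move=> AE; apply/subsetP => x xA; rewrite inE (subsetP AE) //=.
by rewrite (setUidPr _) // sub1set.
Qed.

(** Points of B are added one at a time. Submodularity is applied to A with B minus x and to A with
    x: both have the rank of A, and their intersection contains A. *)
Lemma rk_closureU A B : A \subset E -> B \subset closure A -> rk (A :|: B) = rk A.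
Proof.
move=> AE; have [n] := ubnP #|B|; elim: n B => // n IH B Bn BA.
have [->|[x xB]] := set_0Vmem B; first by rewrite setU0.
have [xE /eqP rx] : x \in E /\ rk (x |: A) == rk A.
  by move/subsetP: BA => /(_ _ xB); rewrite inE => /andP[].
have BxA : B :\ x \subset closure A by apply: subset_trans BA; apply: subsetDl.
have BE := subset_trans BA (closure_sub A).
have ABE : A :|: B :\ x \subset E by rewrite subUset AE (subset_trans _ BE) ?subsetDl.
have rB : rk (A :|: B :\ x) = rk A by apply: IH => //; move: Bn; rewrite (cardsD1 x) xB.
have xAE : x |: A \subset E by rewrite subUset sub1set xE.
have := rk_submod ABE xAE.
have -> : A :|: B :\ x :|: (x |: A) = A :|: B.
  apply/setP => y; rewrite !inE; case: eqP => [->|_]; rewrite ?xB ?orbT //=.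
  by case: (y \in A); rewrite ?orbT // orbF.
have ABxE : (A :|: B :\ x) :&: (x |: A) \subset E by apply: subset_trans ABE; apply: subsetIl.
have := rkS (_ : A \subset (A :|: B :\ x) :&: (x |: A)) ABxE.
rewrite subsetI subsetUl subsetUr => /(_ isT).
have := rkS (subsetUl A B); rewrite subUset AE BE => /(_ isT).
by rewrite rB rx; lia.
Qed.

Lemma rk_closure A : A \subset E -> rk (closure A) = rk A.
Proof.
move=> AE; rewrite -[in RHS](rk_closureU AE (subxx _)).
by rewrite (setUidPr (sub_closure AE)).
Qed.

Lemma closure_flat A : A \subset E -> is_flat M (closure A).
Proof.
move=> AE; apply/is_flatP; split=> [|x xE]; first exact: closure_sub.
rewrite inE xE /= => nx; rewrite rk_closure // ltn_neqAle.
have AxE : x |: A \subset E by rewrite subUset sub1set xE.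
have AxcE : x |: closure A \subset E by rewrite subUset sub1set xE closure_sub.
have le1 := rkS (subsetUr [set x] A) AxE.
have le2 := rkS (setUS [set x] (sub_closure AE)) AxcE.
rewrite (leq_trans le1 le2) andbT; apply: contra nx => /eqP Erk.
by rewrite eqn_leq le1 andbT Erk.
Qed.

(** If x in the closure of A were outside F, submodularity for A with x and for F, whose
    intersection contains A, would show that x does not raise the rank of F. *)
Lemma closure_min A F : is_flat M F -> A \subset F -> closure A \subset F.
Proof.
move=> /is_flatP[FE flF] AF; apply/subsetP => x; rewrite inE => /andP[xE /eqP rx].
apply: contraT => /(flF _ xE).
have AE := subset_trans AF FE; have AxE : x |: A \subset E by rewrite subUset sub1set xE.
have := rk_submod AxE FE; rewrite rx -setUA (setUidPr AF).
have IE : (x |: A) :&: F \subset E by apply: subset_trans FE; apply: subsetIr.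
have := rkS (_ : A \subset (x |: A) :&: F) IE; rewrite subsetI subsetUr AF => /(_ isT).
by lia.
Qed.

End Flats.

(** * The flats of a loopless matroid as a graded lattice with atoms *)

Section FlatLattice.
Variables (T : finType) (M : matroid T).
Hypothesis HM : loopless M.
Let HM1 := proj1 HM.
Local Notation E := (ground M).

Definition flat_type := {F : {set T} | is_flat M F}.
HB.instance Definition _ := Finite.on flat_type.
HB.instance Definition _ := SubType.on flat_type.
Implicit Types F G H : flat_type.

Definition fle F G := val F \subset val G.
Definition frk F := rk M (val F).

Lemma flat0 : is_flat M set0.
Proof.
apply/is_flatP; split=> [|x xE _]; first exact: sub0set.
by rewrite setU0 (rk0 HM1) (proj2 HM).
Qed.

Lemma flat_subU F G : val F :|: val G \subset E.
Proof. by rewrite subUset !flat_sub // ?(valP F) ?(valP G). Qed.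

Definition fjoin F G : flat_type := exist (is_flat M) _ (closure_flat HM1 (flat_subU F G)).
Definition fbot : flat_type := exist (is_flat M) _ flat0.
Definition ftop : flat_type := exist (is_flat M) _ (flat_ground M).
Definition fatom F := frk F == 1%N.

Lemma fle_refl : reflexive fle. Proof. by move=> F; apply: subxx. Qed.
Lemma fle_anti : antisymmetric fle.
Proof. by move=> F G /andP[FG GF]; apply/val_inj/eqP; rewrite eqEsubset; apply/andP. Qed.
Lemma fle_trans : transitive fle.
Proof. by move=> G F H; apply: subset_trans. Qed.
Lemma fle_joinl F G : fle F (fjoin F G).
Proof. exact: subset_trans (subsetUl _ _) (sub_closure (flat_subU F G)). Qed.
Lemma fle_joinr F G : fle G (fjoin F G).
Proof. exact: subset_trans (subsetUr _ _) (sub_closure (flat_subU F G)). Qed.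
Lemma fjoin_le F G H : fle F H -> fle G H -> fle (fjoin F G) H.
Proof. by move=> FH GH; apply: closure_min (valP H) _ => //; rewrite subUset; apply/andP. Qed.

Lemma frk_mono F G : fle F G -> F != G -> (frk F < frk G)%N.
Proof.
move=> FG nFG; apply: flat_rk_lt (valP F) _ (flat_sub (valP G)) => //.
rewrite properE; apply/andP; split=> //; apply: contra nFG => GF.
by apply/eqP/fle_anti; apply/andP.
Qed.

Lemma frk_join F G H : fle F G -> fle F H -> (frk (fjoin G H) + frk F <= frk G + frk H)%N.
Proof.
move=> FG FH; have GE := flat_sub (valP G); have HE := flat_sub (valP H).
rewrite /frk rk_closure ?flat_subU //; apply: leq_trans (rk_submod HM1 GE HE).
rewrite leq_add2l rkS // ?subsetI; first exact/andP.
exact: subset_trans (subsetIl _ _) GE.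
Qed.

Lemma fbot_le F : fle fbot F. Proof. exact: sub0set. Qed.

Lemma frk_atom A : fatom A -> frk A = (frk fbot).+1.
Proof. by move/eqP => ->; rewrite /frk /= rk0. Qed.

(** Intersecting with the ground set makes [atom_of] total; for a in the ground set it is the
    closure of the point a. *)
Lemma atom_of_subproof (a : T) : is_flat M (closure M ([set a] :&: E)).
Proof. by apply: closure_flat => //; apply: subsetIr. Qed.
Definition atom_of a : flat_type := exist (is_flat M) _ (atom_of_subproof a).

Lemma atom_of_le a F : a \in E -> fle (atom_of a) F = (a \in val F).
Proof.
move=> aE; have sa : [set a] :&: E = [set a] by apply/setIidPl; rewrite sub1set.
rewrite /fle /= sa; apply/idP/idP => [/subsetP|aF].
  by apply; apply: (subsetP (sub_closure _)); rewrite ?sub1set ?set11.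
by apply: closure_min (valP F) _ => //; rewrite sub1set.
Qed.

Lemma atom_of_atom a : a \in E -> fatom (atom_of a).
Proof.
move=> aE; have sa : [set a] :&: E = [set a] by apply/setIidPl; rewrite sub1set.
by rewrite /fatom /frk /= sa rk_closure ?sub1set // (proj2 HM).
Qed.

Lemma fatom_sep F G : lt fle F G -> exists A, [/\ fatom A, fle A G & ~~ fle A F].
Proof.
case/andP=> FG nFG; have /subsetPn[a aG naF] : ~~ (val G \subset val F).
  by apply: contra nFG => GF; apply/eqP/fle_anti; apply/andP.
have aE := subsetP (flat_sub (valP G)) _ aG.
by exists (atom_of a); rewrite !atom_of_le // atom_of_atom.
Qed.

Lemma fatomP A : fatom A -> exists2 a, a \in E & A = atom_of a.
Proof.
move=> aA; have [E0|[a aA']] := set_0Vmem (val A).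
  by move: aA; rewrite /fatom /frk E0 rk0.
have aE := subsetP (flat_sub (valP A)) _ aA'.
exists a => //; apply/eqP; rewrite eq_sym; apply: contraT => nA.
have := frk_mono _ nA; rewrite atom_of_le // => /(_ aA').
by rewrite (eqP aA) (eqP (atom_of_atom aE)).
Qed.

End FlatLattice.

(** * Hilbert polynomials of contractions *)

Section Hilbert.
Variable T : finType.
Implicit Types (M : matroid T) (A B F G : {set T}).

(* [hilb M F] is the Chow polynomial of M/F, defined by the recursion of the blow-ups. *)
Fixpoint hilb_fuel M k F : {poly int} :=
  1 + if k is k'.+1 then
    \sum_(G in flats M | F \proper G)
      truncated_geometric (rk M G - rk M F) * hilb_fuel M k' G
  else 0.

(** The complement shrinks strictly when F grows, so its size is enough fuel. *)
Definition hilb M F := hilb_fuel M #|~: F| F.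

Lemma properC_card F G : F \proper G -> (#|~: G| < #|~: F|)%N.
Proof. by move=> FG; apply: proper_card; rewrite properC. Qed.

Lemma hilb_fuelE M k F : (#|~: F| <= k)%N -> hilb_fuel M k F = hilb M F.
Proof.
rewrite /hilb; have [n] := ubnP #|~: F|; elim: n F k => // n IH F k Fn Fk.
case: k Fk => [|k] Fk; first by move: Fk; rewrite leqn0 => /eqP ->.
case E: #|~: F| => [|l] /=; congr (_ + _).
  by apply: big1 => G /andP[_ /properC_card]; rewrite E.
apply: eq_bigr => G /andP[_ /properC_card FG].
by congr (_ * _); rewrite !IH //; lia.
Qed.

Lemma hilb_rec M F : hilb M F = 1 +
  \sum_(G in flats M | F \proper G) truncated_geometric (rk M G - rk M F) * hilb M G.
Proof.
rewrite -[LHS](hilb_fuelE M (leqnSn _)) /=; congr (_ + _).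
apply: eq_bigr => G /andP[_ /properC_card FG].
by rewrite (hilb_fuelE M (ltnW FG)).
Qed.

(** The geometric factor has degree below rk G - rk F, so degrees are bounded by the rank left above
    F. This is what makes the truncation in [chowpoly] lossless. *)
Lemma size_hilb M F : is_matroid M -> is_flat M F ->
  (size (hilb M F) <= (rank M - rk M F).+1)%N.
Proof.
move=> HM; have [n] := ubnP #|~: F|; elim: n F => // n IH F Fn flF.
rewrite hilb_rec; apply: leq_trans (size_polyD _ _) _.
rewrite geq_max size_poly1 /=; apply: leq_trans (size_sum _ _ _) _.
apply/bigmax_leqP => G /andP[]; rewrite inE => flG FG.
have rFG := flat_rk_lt HM flF FG (flat_sub flG).
have rGE : (rk M G <= rank M)%N by rewrite /rank (rkS HM) ?(flat_sub flG).
have sG : (size (hilb M G) <= (rank M - rk M G).+1)%N.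
  by apply: IH => //; apply: leq_trans (properC_card FG) _.
have st : (size (truncated_geometric (rk M G - rk M F)) <= rk M G - rk M F)%N.
  apply: leq_trans (size_sum _ _ _) _; rewrite big_seq.
  by apply/bigmax_leqP_seq => k; rewrite mem_index_iota size_polyXn; lia.
apply: leq_trans (size_polyMleq _ _) _.
have arith a b r g f : (b <= (r - g).+1)%N -> (a <= g - f)%N -> (f < g)%N ->
  (g <= r)%N -> ((a + b).-1 <= (r - f).+1)%N by clear; lia.
exact: arith sG st rFG rGE.
Qed.

(** * Contractions, their flats and their Hilbert polynomials *)

Section Contraction.
Variables (M : matroid T) (F : {set T}).
Hypothesis HM : loopless M.
Hypothesis flF : is_flat M F.
Let HM1 := proj1 HM.
Let MF := contract M F.

Lemma contract_subE A : A \subset ground MF -> A :|: F \subset ground M.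
Proof.
by move=> AE; rewrite subUset (flat_sub flF) andbT (subset_trans AE) ?subsetDl.
Qed.

Lemma contract_rkE A : A \subset ground MF -> (rk M F + rk MF A = rk M (A :|: F))%N.
Proof. by move=> AE; rewrite subnKC // rkS ?subsetUr ?contract_subE. Qed.

Lemma contract_matroid : is_matroid MF.
Proof.
have [le_card _ _] := HM1; split=> [A AE|A B AB BE|A B AE BE].
- have AE' : A \subset ground M by apply: subset_trans AE (subsetDl _ _).
  have := rk_submod HM1 AE' (flat_sub flF); have := le_card _ AE'.
  by have := contract_rkE AE; lia.
- have AE := subset_trans AB BE; have := contract_rkE AE; have := contract_rkE BE.
  have := rkS HM1 (setSU F AB) (contract_subE BE); lia.
have ABE : A :|: B \subset ground MF by rewrite subUset AE.
have IE : A :&: B \subset ground MF by apply: subset_trans AE; apply: subsetIl.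
have := rk_submod HM1 (contract_subE AE) (contract_subE BE).
rewrite setUACA setUid -setUIl.
have := contract_rkE AE; have := contract_rkE BE; have := contract_rkE ABE.
by have := contract_rkE IE; lia.
Qed.

Lemma contract_loopless : loopless MF.
Proof.
split; first exact: contract_matroid.
move=> i; rewrite inE => /andP[iF iE]; apply/eqP; rewrite eqn_leq.
have iMF : [set i] \subset ground MF by rewrite sub1set inE iF.
have [lec _ _] := contract_matroid; have := lec _ iMF; rewrite cards1 => -> /=.
by have /is_flatP[_ /(_ _ iE iF)] := flF; have := contract_rkE iMF; lia.
Qed.

Lemma contract_flats G : (G \in flats MF) = (G \subset ground MF) && (G :|: F \in flats M).
Proof.
rewrite !inE; have [GE|nGE] := boolP (G \subset ground MF); last first.
  by apply/is_flatP => -[GE _]; rewrite GE in nGE.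
apply/is_flatP/is_flatP => -[_ flG]; split=> [|x xE nx] //.
- exact: contract_subE.
- move: nx; rewrite inE negb_or => /andP[xG xF].
  have xE' : x \in ground MF by rewrite inE xF.
  have xGE : x |: G \subset ground MF by rewrite subUset sub1set xE'.
  by have := flG _ xE' xG; have := contract_rkE xGE; have := contract_rkE GE; rewrite -setUA; lia.
have xGE : x |: G \subset ground MF by rewrite subUset sub1set xE.
move: xE; rewrite inE => /andP[xF xE]; have := flG x xE; rewrite inE negb_or nx xF => /(_ isT).
by have := contract_rkE xGE; have := contract_rkE GE; rewrite -setUA; lia.
Qed.

(** Removing F and adding it back are inverse bijections between the flats of M above G and those of
    M/F above G minus F. They preserve rank differences, so the two recursions agree. *)
Lemma hilb_contract G : is_flat M G -> F \subset G -> hilb MF (G :\: F) = hilb M G.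
Proof.
have [n] := ubnP #|~: G|; elim: n G => // n IH G Gn flG FG.
rewrite !hilb_rec; congr (_ + _).
have GDF : G :\: F :|: F = G by rewrite setUC setDE setUIr setUCr setIT; apply/setUidPr.
have DE H : is_flat M H -> H :\: F \subset ground MF by move=> /flat_sub; apply: setSD.
rewrite (reindex_onto (fun H => H :\: F) (fun H => H :|: F)); last first.
  move=> H; rewrite contract_flats => /andP[/andP[HE _] _].
  apply/setP => x; rewrite !inE; case xF: (x \in F); rewrite ?orbF //=.
  by apply/esym/negP => xH; move/subsetP: HE => /(_ _ xH); rewrite inE xF.
apply: eq_big => [H|H].
  have [FsH|nFH] := boolP (F \subset H); last first.
    rewrite [RHS]andbC; have -> : G \proper H = false.
      by apply: contraNF nFH => /andP[GH _]; apply: subset_trans FG GH.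
    apply/negbTE; rewrite negb_and; apply/orP; right; apply: contra nFH => /eqP <-.
    exact: subsetUr.
  have HF : H :\: F :|: F = H by rewrite setUC setDE setUIr setUCr setIT; apply/setUidPr.
  rewrite contract_flats HF eqxx andbT.
  have -> : (G :\: F \proper H :\: F) = (G \proper H).
    rewrite !properE; congr (_ && ~~ _); apply/idP/idP => [|/setSD//].
      by move/(setSU F); rewrite GDF HF.
    by move/(setSU F); rewrite GDF HF.
  rewrite inE; case flH: (is_flat M H); rewrite ?andbF // andbT.
  by rewrite DE.
move=> /andP[/andP[]]; rewrite contract_flats inE => /andP[HE flH] GH /eqP HF.
rewrite HF in flH.
have GsH : G \proper H.
  rewrite -HF -GDF properE setSU /=; last by case/andP: GH.
  apply: contra (proj2 (andP GH)) => /(setSD F).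
  by rewrite !setDUl !setDv !setU0 !setDDl !setUid.
have GE := DE _ flG.
rewrite IH //; last 2 first.
- by apply: leq_trans (properC_card GsH) _.
- by apply: subset_trans FG _; case/andP: GsH.
congr (truncated_geometric _ * _).
have := contract_rkE HE; have := contract_rkE GE; rewrite HF GDF.
by rewrite -/MF; lia.
Qed.

End Contraction.
End Hilbert.

(** * The Chow ring of a matroid *)

Lemma ideal_prod_congr (S : comNzRingType) (gen : S -> Prop) (I : Type) (r : seq I)
    (f g : I -> S) :
  (forall i, ideal gen (f i - g i)) ->
  ideal gen (\prod_(i <- r) f i - \prod_(i <- r) g i).
Proof.
move=> fg; apply: (big_ind2 (fun x y => ideal gen (x - y))) => [||i _] //.
  by rewrite subrr; apply: ideal0.
by move=> *; apply: ideal_congrM.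
Qed.

Lemma ideal_exp_congr (S : comNzRingType) (gen : S -> Prop) (p q : S) k :
  ideal gen (p - q) -> ideal gen (p ^+ k - q ^+ k).
Proof. by move=> pq; rewrite subrXX; apply: idealMr. Qed.

Lemma ideal_mpoly_congr (K : comNzRingType) (n : nat) (A : comNzRingType)
    (gen : A -> Prop) (f g : {rmorphism {mpoly K[n]} -> A}) p :
    (forall c, f c%:MP = g c%:MP) -> (forall i, ideal gen (f 'X_i - g 'X_i)) ->
  ideal gen (f p - g p).
Proof.
move=> fgC fgX; elim/mpolyind: p => [|c m p _ _ IH].
  by rewrite !rmorph0 subrr; apply: ideal0.
rewrite !rmorphD opprD addrACA; apply: idealD => //.
rewrite -mul_mpolyC !rmorphM fgC -mulrBr; apply: idealMl.
rewrite mpolyXE_id !rmorph_prod; apply: ideal_prod_congr => i.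
by rewrite !rmorphXn; apply: ideal_exp_congr.
Qed.

Section ChowRing.
Variables (T : finType) (M : matroid T).
Hypothesis HM : loopless M.
Local Notation E := (ground M).
Local Notation L := (flat_type M).
Local Notation S := {mpoly rat[#|{: L}|]}.
Local Notation R := {mpoly rat[nvar M]}.
Local Notation X := (@flatX rat L).
Local Notation bot := (fbot HM).
Local Notation hh := (@flath rat L (@fle T M) (above (@fle T M) bot)).
Local Notation arels := (@atom_rels rat L (@fle T M) bot (@fatom T M)).

Inductive chow_rels : R -> Prop :=
| chow_inc i k of incomparable_vars (i, k) : chow_rels ('X_i * 'X_k)
| chow_lin a b of a \in E & b \in E : chow_rels (lin_form M a - lin_form M b).

(* x_E is eliminated through x_E = - sum_(F containing a) x_F, for a fixed a in E. *)
Definition lin0 : R := if [pick a in E] is Some a then lin_form M a else 0.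

(** For a nonempty proper flat the sum has the single term x_F; as a sum it is defined without a
    proof that F is such a flat. *)
Definition flat_var (F : {set T}) : R :=
  if F == set0 then 0 else if F == E then - lin0
  else \sum_(i < nvar M | varflat i == F) 'X_i.

Definition to_chow : {rmorphism S -> R} :=
  locked (mmap (@mpolyC _ rat) (fun j => flat_var (val (enum_val j))) : {rmorphism S -> R}).

Definition of_chow : {rmorphism R -> S} :=
  locked (mmap (@mpolyC _ rat) (fun i => X (insubd bot (varflat i))) : {rmorphism R -> S}).

Lemma to_chowC c : to_chow c%:MP = c%:MP.
Proof. by rewrite /to_chow -lock /= mmapC. Qed.

Lemma to_chowXi j : to_chow 'X_j = flat_var (val (enum_val j)).
Proof. by rewrite /to_chow -lock /= mmapX mmap1U. Qed.

Lemma to_chowX G : to_chow (X G) = flat_var (val G).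
Proof. by rewrite to_chowXi enum_rankK. Qed.

Lemma of_chowC c : of_chow c%:MP = c%:MP.
Proof. by rewrite /of_chow -lock /= mmapC. Qed.

Lemma of_chowX i : of_chow 'X_i = X (insubd bot (varflat i)).
Proof. by rewrite /of_chow -lock /= mmapX mmap1U. Qed.

Lemma varflatP (i : 'I_(nvar M)) :
  [/\ is_flat M (varflat i), varflat i != set0 & varflat i != E].
Proof. by have := enum_valP i; rewrite !inE => /andP[-> /andP[-> ->]]. Qed.

Lemma insub_varflat (i : 'I_(nvar M)) : val (insubd bot (varflat i)) = varflat i.
Proof. by have [fl _ _] := varflatP i; rewrite insubdK. Qed.

(** [lin_form] runs over proper flats only, whereas the form of an atom also contains x_E. *)
Lemma of_chow_lin a : a \in E ->
  of_chow (lin_form M a) = hh (atom_of HM a) - X (ftop M).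
Proof.
move=> aE; have Ebot : bot != ftop M.
  by apply/eqP => /(congr1 val) /= E0; move: aE; rewrite -E0 inE.
rewrite /flath (bigD1 (ftop M)) /=; last first.
  rewrite (above_bot (@fbot_le T M HM)) eq_sym Ebot atom_of_le //=.
rewrite [RHS]addrAC subrr add0r /lin_form raddf_sum /=.
rewrite (eq_bigr (fun i => X (insubd bot (varflat i)))) => [|i _]; last exact: of_chowX.
have -> : \sum_(i < nvar M | a \in varflat i) X (insubd bot (varflat i)) =
    \sum_(F in pflats M | a \in F) X (insubd bot F) by rewrite big_enum_val_cond.
rewrite (reindex_onto val (insubd bot)) /=; last first.
  by move=> F; rewrite !inE => /andP[/andP[flF _] _]; rewrite insubdK.
apply: eq_big => [G|G /andP[_ /eqP -> //]].
rewrite (above_bot (@fbot_le T M HM)) atom_of_le // !inE valKd eqxx andbT (valP G) /=.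
by rewrite -[G == bot]/(val G == set0) -[G == ftop M]/(val G == E) andbAC.
Qed.

Lemma to_of_chow p : to_chow (of_chow p) = p.
Proof.
apply: (mpoly_rmorph_ext (f := to_chow \o of_chow) (g := idfun)) => [c|i] /=.
  by rewrite of_chowC to_chowC.
rewrite of_chowX to_chowX insub_varflat; have [_ n0 nE] := varflatP i.
rewrite /flat_var (negbTE n0) (negbTE nE) (big_pred1 i) // => k.
by rewrite /= (inj_eq enum_val_inj).
Qed.

Lemma of_chow_rels p : ideal chow_rels p -> ideal arels (of_chow p).
Proof.
apply: (ideal_morph (f := of_chow)) => _ [i k /andP[/= nik nki]|a b aE bE].
  rewrite rmorphM !of_chowX; apply: ideal_gen.
  by apply: arel_inc; rewrite /fle !insub_varflat.
rewrite rmorphB !of_chow_lin // opprB addrA subrK.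
by apply: idealB; apply/ideal_gen/arel_atom/atom_of_atom.
Qed.

Lemma to_chow_rels p : ideal arels p -> ideal chow_rels (to_chow p).
Proof.
apply: (ideal_morph (f := to_chow)) => _ [|G H nGH nHG|A aA].
- by rewrite to_chowX /flat_var eqxx; apply: ideal0.
(* Incomparable flats are neither empty nor the whole ground set, so both images are genuine
   variables. *)
- have flat_varE (G' H' : L) : ~~ fle G' H' -> ~~ fle H' G' ->
    flat_var (val G') = \sum_(i < nvar M | varflat i == val G') 'X_i.
    rewrite /flat_var /fle => nGH' nHG'; case: eqP nGH' => [->|_ nGH'].
      by rewrite sub0set.
    by case: eqP nHG' => [->|//] /negP[]; exact: flat_sub (valP H').
  rewrite rmorphM !to_chowX (flat_varE _ H) // (flat_varE _ G) //.
  rewrite mulr_suml; apply: ideal_sum => i /eqP iG.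
  rewrite mulr_sumr; apply: ideal_sum => k /eqP kH.
  by apply/ideal_gen/chow_inc; rewrite /incomparable_vars /= iG kH nGH.
have [a aE ->] := fatomP HM aA.
(* As x_E is sent to minus the form of the chosen point b, the form of an atom is sent to a
   difference of two linear forms. *)
have -> : hh (atom_of HM a) = of_chow (lin_form M a) + X (ftop M).
  by rewrite of_chow_lin // subrK.
rewrite rmorphD to_of_chow to_chowX /flat_var /=; case: eqP => [E0|_].
  by move: aE; rewrite E0 inE.
rewrite eqxx /lin0; case: pickP => [b bE|/(_ a)]; last by rewrite aE.
exact/ideal_gen/chow_lin.
Qed.

(** Only the two extreme variables change: x_E returns with an error equal to minus the form of an
    atom, and the bottom variable is itself a relation. *)
Lemma of_to_chow p : ideal arels (of_chow (to_chow p) - p).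
Proof.
apply: (ideal_mpoly_congr (f := of_chow \o to_chow) (g := idfun)) => [c|j] /=.
  by rewrite to_chowC of_chowC.
rewrite -[j]enum_valK; set G := enum_val j; rewrite [to_chow _]to_chowX /flat_var.
case: eqP => [G0|/eqP G0].
  have -> : G = bot by apply: val_inj.
  by rewrite rmorph0 sub0r; apply/idealN/ideal_gen/arel_bot.
case: eqP => [GE|/eqP GE].
  have -> : G = ftop M by apply: val_inj.
  rewrite /lin0; case: pickP => [b bE|noE].
    rewrite rmorphN of_chow_lin // opprB addrAC subrr sub0r.
    by apply/idealN/ideal_gen/arel_atom/atom_of_atom.
  by case/eqP: G0; rewrite GE; apply/setP => x; rewrite inE noE.
have pG : val G \in pflats M by rewrite !inE G0 GE (valP G).
rewrite (big_pred1 (enum_rank_in pG (val G))); last first.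
  move=> k /=; rewrite -(inj_eq enum_val_inj) /= enum_rankK_in //.
rewrite of_chowX /varflat enum_rankK_in // valKd subrr; exact: ideal0.
Qed.

(** The basis is kept as monomials in the variables of all flats, since their images need not be
    monomials once x_E is eliminated. *)
Lemma chow_basis : exists bs : seq 'X_{1..#|{: L}|},
  [/\ uniq bs,
      forall p : R, exists2 q, supported bs q & ideal chow_rels (p - to_chow q),
      forall q, supported bs q -> ideal chow_rels (to_chow q) -> q = 0 &
      hilb M set0 = \sum_(m <- bs) 'X^(mdeg m)].
Proof.
have recN (F : L) : hilb M (val F) = 1 + \sum_(G in above (@fle T M) F)
    truncated_geometric (frk G - frk F) * hilb M (val G).
  rewrite hilb_rec; congr (_ + _); rewrite (reindex_onto val (insubd bot)) /=; last first.
    by move=> F'; rewrite inE => /andP[flF' _]; rewrite insubdK.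
  apply: eq_bigl => G; rewrite !inE valKd eqxx andbT (valP G) /lt /fle /=.
  by rewrite properEneq andbC -(inj_eq val_inj).
have [bs [ub sb fb] E] := atom_rels_hilbert rat (@fle_refl T M) (@fle_anti T M)
  (@fle_trans T M) (@fle_joinl T M HM) (@fle_joinr T M HM) (@fjoin_le T M HM)
  (@frk_mono T M HM) (@frk_join T M HM) (@fbot_le T M HM) (@frk_atom T M HM)
  (@fatom_sep T M HM) recN.
exists bs; split=> // [p|q sq Iq].
  have [q sq Iq] := sb (of_chow p); exists q => //.
  by rewrite -{1}[p]to_of_chow -rmorphB; apply: to_chow_rels.
apply: fb => //; apply: ideal_congr (of_chow_rels Iq); rewrite -opprB.
exact/idealN/of_to_chow.
Qed.

End ChowRing.

Lemma span_ind (K : fieldType) (V : vectType K) (X : seq V) (P : V -> Prop) :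
    P 0 -> (forall u v, P u -> P v -> P (u + v)) -> (forall a v, P v -> P (a *: v)) ->
    (forall v, v \in X -> P v) ->
  forall v, v \in <<X>>%VS -> P v.
Proof.
move=> P0 PD PZ PX v; rewrite -[X]/(tval (in_tuple X)) => /coord_span ->.
by apply: big_ind => // i _; apply/PZ/PX/mem_nth.
Qed.

(** * Graded pieces of the Chow ideal as spans of coefficient vectors *)

Section ChowDim.
Variables (T : finType) (M : matroid T).
Local Notation E := (ground M).
Local Notation R := {mpoly rat[nvar M]}.
Local Notation mons j := ('X_{1..(nvar M) < j.+1}).
Variable j : nat.
Local Notation vec := (@coefvec T M j).

Lemma coefvec_linear : linear vec.
Proof. by move=> a p q; apply/rowP => k; rewrite !mxE mcoeffD mcoeffZ. Qed.
HB.instance Definition _ := GRing.isLinear.Build rat R _ _ vec coefvec_linear.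

Definition polyvec (v : 'rV[rat]_#|{: mons j}|) : R :=
  \sum_k v 0 k *: 'X_[val (enum_val k)].

Lemma polyvec_linear : linear polyvec.
Proof.
move=> a u v; rewrite /polyvec scaler_sumr -big_split /=; apply: eq_bigr => k _.
by rewrite !mxE scalerDl scalerA.
Qed.
HB.instance Definition _ := GRing.isLinear.Build rat _ R _ polyvec polyvec_linear.

Lemma coefvecK p : p \is j.-homog -> polyvec (vec p) = p.
Proof.
move=> /dhomogP hp; rewrite [RHS](mpolywE (k := j.+1)); last first.
  rewrite msizeE; apply/bigmax_leqP_seq => m mp _; by rewrite (hp m mp).
rewrite /polyvec; under eq_bigr do rewrite mxE.
by rewrite [RHS](big_enum_val (fun m : mons j => p@_(val m) *: 'X_[val m])).
Qed.

Lemma homog_gens_span p : p \is j.-homog ->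
  vec p \in <<[seq vec p | p <- homog_gens M j]>>%VS.
Proof.
move=> /dhomogP hp; rewrite [p]mpolyE raddf_sum big_seq; apply: memv_suml => m mp /=.
have dm := hp m mp; have lm : (mdeg m < j.+1)%N by rewrite dm.
rewrite linearZ; apply/memvZ/memv_span/map_f/mapP.
by exists (BMultinom lm) => //; rewrite mem_filter mem_enum /= dm eqxx.
Qed.

Lemma homog_gens_homog p : p \in homog_gens M j -> p \is j.-homog.
Proof. by case/mapP=> m; rewrite mem_filter => /andP[dm _] ->; rewrite dhomogX. Qed.

Lemma lin_form_homog a : lin_form M a \is 1.-homog.
Proof. by apply: rpred_sum => i _; rewrite dhomogX /= mdeg1. Qed.

Lemma inc_homog (m : 'X_{1..nvar M}) (i k : 'I_(nvar M)) :
  'X_[m] * ('X_i * 'X_k) \is [in rat[nvar M], (mdeg m + 2).-homog].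
Proof.
apply: dhomogM; rewrite ?dhomogX //.
by apply: (@dhomogM _ _ _ 1 _ 1); rewrite dhomogX /= mdeg1.
Qed.

Lemma lin_homog (m : 'X_{1..nvar M}) a b :
  'X_[m] * (lin_form M a - lin_form M b) \is [in rat[nvar M], (mdeg m + 1).-homog].
Proof.
by apply: dhomogM; rewrite ?dhomogX //; apply: rpredB; apply: lin_form_homog.
Qed.

Lemma ideal_gens_sub p : p \in ideal_gens M j ->
  p \is j.-homog /\ ideal (@chow_rels T M) p.
Proof.
rewrite mem_cat => /orP[] /mapP[[m [a b]]]; rewrite mem_filter /= => /andP[].
  move=> /andP[/eqP dm inc] _ ->; split; last exact/idealMl/ideal_gen/chow_inc.
  by have := inc_homog m a b; rewrite dm.
case/and3P=> /eqP dm aE bE _ ->; split; last exact/idealMl/ideal_gen/chow_lin.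
by have := lin_homog m a b; rewrite dm.
Qed.

(** A monomial times a generator is homogeneous, so its part of degree j is either itself, a member
    of [ideal_gens], or zero. *)
Lemma chow_rels_gens g m : chow_rels g ->
  vec (pihomog mdeg j ('X_[m] * g)) \in <<[seq vec p | p <- ideal_gens M j]>>%VS.
Proof.
have homog_case d p : p \is d.-homog -> (d = j -> p \in ideal_gens M j) ->
    vec (pihomog mdeg j p) \in <<[seq vec p | p <- ideal_gens M j]>>%VS.
  move=> hp; have [dj|dj] := eqVneq d j => [/(_ dj) jp | _].
    by rewrite dj in hp; rewrite pihomog_dE //; apply/memv_span/map_f.
  by rewrite (pihomog_ne0 dj hp) raddf0 mem0v.
case=> [i k inc|a b aE bE].
  apply: homog_case (inc_homog m i k) _ => dm; rewrite mem_cat; apply/orP; left.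
  have lm : (mdeg m < j.+1)%N by lia.
  by apply/mapP; exists (BMultinom lm, (i, k)); rewrite // mem_filter mem_enum /= inc dm eqxx.
apply: homog_case (lin_homog m a b) _ => dm; rewrite mem_cat; apply/orP; right.
have lm : (mdeg m < j.+1)%N by lia.
by apply/mapP; exists (BMultinom lm, (a, b)); rewrite // mem_filter mem_enum /= aE bE dm eqxx.
Qed.

Lemma ideal_homog_part p : ideal (@chow_rels T M) p ->
  vec (pihomog mdeg j p) \in <<[seq vec p | p <- ideal_gens M j]>>%VS.
Proof.
elim=> [|q g {}p gg _ IH]; first by rewrite !raddf0 mem0v.
rewrite !raddfD memvD //.
elim/mpolyind: q => [|c m q _ _ IHq]; first by rewrite mul0r !raddf0 mem0v.
rewrite mulrDl -scalerAl !raddfD /= memvD // !linearZ memvZ //.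
exact: chow_rels_gens.
Qed.

Lemma polyvec_ideal v : v \in <<[seq vec p | p <- ideal_gens M j]>>%VS ->
  ideal (@chow_rels T M) (polyvec v).
Proof.
elim/span_ind => [|u w Iu Iw|a u Iu|_ /mapP[p /ideal_gens_sub[hp Ip] ->]].
- by rewrite raddf0; apply: ideal0.
- by rewrite raddfD; apply: idealD.
- by rewrite linearZZ -mul_mpolyC; apply: idealMl.
by rewrite coefvecK.
Qed.

End ChowDim.

(** * Dimensions of the graded pieces from a monomial basis *)

Section ChowDimension.
Variables (T : finType) (M : matroid T).
Local Notation L := (flat_type M).
Local Notation S := {mpoly rat[#|{: L}|]}.
Local Notation R := {mpoly rat[nvar M]}.
Local Notation phi := (to_chow M).

Lemma flat_var_homog F : flat_var M F \is 1.-homog.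
Proof.
rewrite /flat_var; case: ifP => _; first exact: rpred0.
case: ifP => _; last by apply: rpred_sum => i _; rewrite dhomogX /= mdeg1.
rewrite rpredN /lin0; case: pickP => [a _|_]; last exact: rpred0.
exact: lin_form_homog.
Qed.

Lemma to_chow_homog m : phi 'X_[m] \is (mdeg m).-homog.
Proof.
rewrite mpolyXE_id rmorph_prod mdegE.
apply: (big_ind2 (fun (p : R) d => p \is d.-homog)) => [||i _]; first exact: dhomog1.
  by move=> p d q e; apply: dhomogM.
rewrite rmorphXn to_chowXi -[X in X.-homog]mul1n.
exact/dhomogMn/flat_var_homog.
Qed.

Lemma to_chowZ c p : phi (c *: p) = c *: phi p.
Proof. by rewrite -mul_mpolyC rmorphM to_chowC mul_mpolyC. Qed.

Lemma to_chow_pihomog j q : phi (pihomog mdeg j q) = pihomog mdeg j (phi q).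
Proof.
elim/mpolyind: q => [|c m q _ _ IH]; first by rewrite !(raddf0, rmorph0).
rewrite !(raddfD, rmorphD) /= IH; congr (_ + _).
rewrite linearZ /= !to_chowZ linearZ /= pihomogX; congr (_ *: _).
case: eqP => [<-|/eqP dm]; first by rewrite pihomog_dE ?to_chow_homog.
by rewrite rmorph0 (pihomog_ne0 dm (to_chow_homog m)).
Qed.

Lemma supported_pihomog (bs : seq 'X_{1..#|{: L}|}) j (q : S) :
  supported bs q -> supported [seq m <- bs | mdeg m == j] (pihomog mdeg j q).
Proof.
elim/supported_ind => [|p p' sp sp'|c m mb]; first by rewrite raddf0; apply: supported0.
  by rewrite raddfD; apply: supportedD.
rewrite linearZ /= pihomogX; case: ifP => dm; apply: supportedZ; last exact: supported0.
by apply: supportedX; rewrite mem_filter /= mb andbT.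
Qed.

Lemma supported_homog (bs : seq 'X_{1..#|{: L}|}) j (q : S) :
  supported [seq m <- bs | mdeg m == j] q -> phi q \is j.-homog.
Proof.
elim/supported_ind => [|p p' sp sp'|c m]; first by rewrite rmorph0 rpred0.
  by rewrite rmorphD; apply: rpredD.
rewrite mem_filter => /andP[/eqP <- _]; rewrite to_chowZ; exact/rpredZ/to_chow_homog.
Qed.

(** The images of the basis monomials of degree j are independent and span a complement of the
    degree j part W of the ideal in the space V of all forms of degree j, so the difference of
    dimensions counts them. *)
Lemma chow_dimE (bs : seq 'X_{1..#|{: L}|}) j :
    uniq bs ->
    (forall p, exists2 q, supported bs q & ideal (@chow_rels T M) (p - phi q)) ->
    (forall q, supported bs q -> ideal (@chow_rels T M) (phi q) -> q = 0) ->
  chow_dim M j = count (fun m => mdeg m == j) bs.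
Proof.
move=> ubs spans free_bs; set bsj := [seq m <- bs | mdeg m == j].
pose us := [seq coefvec j (phi 'X_[m]) | m <- bsj].
rewrite /chow_dim; set V := <<_>>%VS; set W := <<_>>%VS.
have sub_bs q : supported bsj q -> supported bs q.
  by apply: supported_sub => m; rewrite mem_filter => /andP[].
have phi_free q : supported bsj q -> coefvec j (phi q) \in W -> q = 0.
  move=> sq /polyvec_ideal; rewrite coefvecK; last exact: supported_homog sq.
  by apply: free_bs; apply: sub_bs.
have VE : V = (<<us>> + W)%VS.
  apply/eqP; rewrite eqEsubv subv_add; apply/and3P; split.
  - apply/span_subvP => _ /mapP[p /homog_gens_homog hp ->].
    (* As [phi] is graded, the degree j part of the normal form q differs from p by the degree j
       part of an ideal element. *)
    have [q sq Iq] := spans p; set q' := phi (pihomog mdeg j q).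
    have -> : coefvec j p = coefvec j q' + coefvec j (p - q') by rewrite -raddfD /= addrC subrK.
    apply: memv_add; last first.
      by have := ideal_homog_part j Iq; rewrite raddfB /= -to_chow_pihomog pihomog_dE.
    rewrite /q'; elim/supported_ind: (supported_pihomog (j := j) sq) => [|u v su sv|c m mb].
    + by rewrite rmorph0 raddf0 mem0v.
    + by rewrite rmorphD raddfD memvD.
    by rewrite to_chowZ linearZ; apply/memvZ/memv_span/mapP; exists m.
  - apply/span_subvP => u /mapP[m]; rewrite mem_filter => /andP[/eqP dm _] ->.
    by apply: homog_gens_span; rewrite -[X in X.-homog]dm to_chow_homog.
  apply/span_subvP => _ /mapP[p /ideal_gens_sub[hp _] ->]; exact: homog_gens_span.
have UW0 : (<<us>> :&: W)%VS = 0%VS.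
  apply/eqP; rewrite -subv0; apply/subvP => v /memv_capP[vU vW].
  have [q sq Ev] : exists2 q, supported bsj q & v = coefvec j (phi q).
    elim/span_ind: vU => [|_ _ [q sq ->] [q' sq' ->]|a _ [q sq ->]|_ /mapP[m mb ->]].
    + by exists 0; [apply: supported0 | rewrite rmorph0 raddf0].
    + by exists (q + q'); [apply: supportedD | rewrite rmorphD raddfD].
    + by exists (a *: q); [apply: supportedZ | rewrite to_chowZ linearZ].
    by exists 'X_[m] => //; apply: supportedX.
  rewrite Ev in vW *; rewrite (phi_free _ sq vW) rmorph0 raddf0; exact: mem0v.
rewrite VE dimv_disjoint_sum // addnK.
suff /eqP -> : free us by rewrite size_map size_filter.
rewrite -[us]/(tval (in_tuple us)); apply/freeP => k /= k0 i.
have szus : size us = size bsj by rewrite size_map.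
have lts (l : 'I_(size us)) : (l < size bsj)%N by rewrite -szus.
(* A linear relation among the vectors is the image of a combination of basis monomials, which must
   then be zero. *)
pose q : S := \sum_l k l *: 'X_[nth 0%MM bsj l].
have q0 : q = 0.
  apply: phi_free.
    rewrite /q; apply: big_ind => [||l _]; [exact: supported0|exact: supportedD|].
    by apply/supportedZ/supportedX/mem_nth.
  rewrite /q rmorph_sum raddf_sum /= (_ : \sum_l _ = 0) ?mem0v // -[RHS]k0.
  by apply: eq_bigr => l _; rewrite to_chowZ linearZ /= (nth_map 0%MM).
have /(congr1 (mcoeff (nth 0%MM bsj i))) := q0; rewrite mcoeff0 /q raddf_sum /= => <-.
rewrite (bigD1 i) //= mcoeffZ mcoeffX eqxx mulr1 big1 ?addr0 // => l li.
by rewrite mcoeffZ mcoeffX nth_uniq ?filter_uniq // val_eqE (negbTE li) mulr0.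
Qed.

End ChowDimension.

(** * The recursion *)

Section ChowPolynomial.
Variables (T : finType) (M : matroid T).
Hypothesis HM : loopless M.
Let HM1 := proj1 HM.
Local Notation E := (ground M).
Local Notation rk := (rk M).
Implicit Types (A B F G H : {set T}).

Lemma chow_dim_hilb j : (chow_dim M j)%:Z = (hilb M set0)`_j.
Proof.
have [bs [ubs spans fbs ->]] := chow_basis HM.
rewrite (chow_dimE j ubs spans fbs) coef_sum -sum1_count -natz natr_sum big_mkcond /=.
by apply: eq_bigr => m _; rewrite coefXn eq_sym; case: eqP.
Qed.

Lemma size_hilb0 : (size (hilb M set0) <= (rank M).+1)%N.
Proof. by have := size_hilb HM1 (flat0 HM); rewrite rk0 // subn0. Qed.

Lemma chow_dim_gt_rank j : (rank M < j)%N -> chow_dim M j = 0%N.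
Proof.
move=> rj; apply/eqP; rewrite -eqz_nat chow_dim_hilb nth_default //.
exact: leq_trans size_hilb0 rj.
Qed.

Lemma chowpolyE : chowpoly M = hilb M set0.
Proof.
apply/polyP => j; rewrite coef_poly -chow_dim_hilb; case: ltnP => // rj.
by rewrite chow_dim_gt_rank.
Qed.

Lemma mob_fuelE k A B : (#|B| <= k)%N -> mob_fuel M k A B = mobius M A B.
Proof.
rewrite /mobius; have [n] := ubnP #|B|; elim: n k B => // n IH k B Bn Bk.
have [B0|B0] := eqVneq #|B| 0%N.
  have {}B0 := cards0_eq B0; rewrite B0 cards0; case: k {Bk} => [|k] //=.
  by rewrite subset0; case: eqP.
case: k Bk => [|k] Bk; first by rewrite leqn0 (negbTE B0) in Bk.
case EB: #|B| B0 => [//|l] _ /=; case: ifP => // _; case: ifP => // _.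
congr (- _); apply: eq_bigr => H /andP[_ /andP[_ /proper_card HB]].
by rewrite !IH //; lia.
Qed.

Lemma mobius_refl A : mobius M A A = 1.
Proof. by rewrite /mobius; case: #|A| => [|k] /=; rewrite eqxx. Qed.

Lemma sum_mobius F : is_flat M F ->
  \sum_(G in flats M | G \subset F) mobius M set0 G = (F == set0)%:R.
Proof.
move=> flF; rewrite (bigD1 F) /=; last by rewrite inE flF subxx.
have [->|F0] := eqVneq F set0.
  rewrite mobius_refl big1 ?addr0 // => G /andP[/andP[_]]; rewrite subset0.
  by move=> ->.
rewrite [in X in X + _]/mobius; case EF: #|F| => [|k]; first by rewrite (cards0_eq EF) eqxx in F0.
rewrite /= eq_sym (negbTE F0) sub0set; apply/eqP; rewrite addrC subr_eq0; apply/eqP.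
apply: eq_big => [G|G /andP[/andP[_ GF] nGF]].
  by rewrite sub0set /= properEneq andbAC andbA.
rewrite mob_fuelE // -ltnS -EF; apply: proper_card.
by rewrite properEneq nGF GF.
Qed.

(** A flat G of the restriction has its closure in M inside F, so points outside F raise its rank as
    well. *)
Lemma restrict_flats F G : is_flat M F ->
  (G \in flats (restrict M F)) = (G \in flats M) && (G \subset F).
Proof.
move=> flF; rewrite !inE; have FE := flat_sub flF.
apply/is_flatP/andP => /= [[GF flG]|[/is_flatP[GE flG] GF]]; split=> //.
  apply/is_flatP; split=> [|x xE xG]; first exact: subset_trans GF FE.
  have [xF|nxF] := boolP (x \in F); first exact: flG.
  have GE := subset_trans GF FE.
  have xGE : x |: G \subset E by rewrite subUset sub1set xE.
  rewrite ltn_neqAle rkS ?subsetUr // andbT; apply: contra nxF => /eqP Erk.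
  by apply: (subsetP (closure_min HM1 flF GF)); rewrite inE xE Erk eqxx.
by move=> x xF; apply/flG/(subsetP FE).
Qed.

Lemma restrict_mob k F A B : is_flat M F -> B \subset F ->
  mob_fuel (restrict M F) k A B = mob_fuel M k A B.
Proof.
move=> flF; elim: k B => [|k IH] B BF //=; case: ifP => // _; case: ifP => // _.
congr (- _); apply: eq_big => [H|H /andP[_ /andP[_ HB]]].
  rewrite restrict_flats //; case HB: (H \proper B); rewrite ?andbF // !andbT.
  by rewrite (subset_trans (proper_sub HB) BF) andbT.
by apply: IH; apply: subset_trans (proper_sub HB) BF.
Qed.

Lemma restrict_charpoly F : is_flat M F -> charpoly (restrict M F) =
  \sum_(G in flats M | G \subset F) mobius M set0 G *: 'X^(rk F - rk G).
Proof.
move=> flF; apply: eq_big => [G|G]; rewrite restrict_flats // => /andP[_ GF].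
by rewrite /mobius restrict_mob.
Qed.

(** At x = 1 the characteristic polynomial is a full Moebius sum, which is zero for F nonempty, so
    the division by x - 1 is exact. *)
Lemma redcharpoly_restrict F : is_flat M F -> F != set0 ->
  ('X - 1) * redcharpoly (restrict M F) = charpoly (restrict M F).
Proof.
move=> flF F0; rewrite /redcharpoly /= (negbTE F0).
have : root (charpoly (restrict M F)) 1.
  rewrite rootE restrict_charpoly // horner_sum.
  under eq_bigr do rewrite hornerZ hornerXn expr1n mulr1.
  by rewrite sum_mobius // (negbTE F0).
case/factor_theorem => q ->; rewrite polyC1 mulrC; congr (_ * _).
by rewrite Pdiv.IdomainMonic.mulpK ?monicXsubC.
Qed.

Lemma truncated_geometricE r : (0 < r)%N ->
  ('X - 1) * truncated_geometric r = 'X^r - 'X.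
Proof.
case: r => // r _; elim: r => [|r IH].
  by rewrite /truncated_geometric big_geq // mulr0 expr1 subrr.
rewrite /truncated_geometric big_nat_recr //= mulrDr [X in X + _]IH.
by rewrite mulrBl mul1r -exprS addrC addrA subrK.
Qed.

(* The recursion defining [hilb], multiplied by x - 1. *)
Lemma sum_hilb G : is_flat M G ->
  \sum_(F in flats M | G \subset F) 'X^(rk F - rk G) * hilb M F =
  'X * \sum_(F in flats M | G \subset F) hilb M F - ('X - 1).
Proof.
move=> flG.
have split_sum (f : {set T} -> {poly int}) :
    \sum_(F in flats M | G \subset F) f F =
    f G + \sum_(F in flats M | G \proper F) f F.
  rewrite (bigD1 G) /=; last by rewrite inE flG subxx.
  by congr (_ + _); apply: eq_bigl => F; rewrite properEneq eq_sym -andbA [(G != F) && _]andbC.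
have rec : ('X - 1) * hilb M G = ('X - 1) +
    (\sum_(F in flats M | G \proper F) 'X^(rk F - rk G) * hilb M F -
     'X * \sum_(F in flats M | G \proper F) hilb M F).
  rewrite hilb_rec mulrDr mulr1; congr (_ + _); rewrite mulr_sumr mulr_sumr -sumrB.
  apply: eq_bigr => F /andP[]; rewrite inE => flF GF; rewrite mulrA -mulrBl.
  by rewrite truncated_geometricE // subn_gt0; apply: flat_rk_lt (flat_sub flF).
rewrite !split_sum subnn expr0 mul1r mulrDr.
set s := (\sum_(F in _ | _) _ * _) in rec *; set t := 'X * _ in rec *.
have -> : s = ('X - 1) * hilb M G - ('X - 1) + t by rewrite rec [_ + (s - t)]addrC addrK subrK.
by rewrite mulrBl mul1r -!addrA addrCA addNKr; congr (_ + _); rewrite addrC.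
Qed.

(** After multiplication by x - 1 it remains to see that the sum of the products of characteristic
    polynomials and H_F over all flats is x times H at the empty flat. Exchanging the sums over F
    and over the Moebius index G makes [sum_hilb] applicable to the inner sum. *)
Lemma hilb_redcharpoly : E != set0 ->
  hilb M set0 = \sum_(F in flats M | F != set0) redcharpoly (restrict M F) * hilb M F.
Proof.
move=> E0; have X1 : 'X - 1 != 0 :> {poly int} by rewrite monic_neq0 // monicXsubC.
apply: (mulfI X1); rewrite mulr_sumr.
have -> : \sum_(F in flats M | F != set0) ('X - 1) * (redcharpoly (restrict M F) * hilb M F) =
    \sum_(F in flats M) charpoly (restrict M F) * hilb M F - hilb M set0.
  have -> : \sum_(F in flats M) charpoly (restrict M F) * hilb M F =
      hilb M set0 + \sum_(F in flats M | F != set0) charpoly (restrict M F) * hilb M F.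
    rewrite (bigD1 set0) /=; last by rewrite inE flat0.
    rewrite restrict_charpoly ?flat0 // (big_pred1 set0) => [|G /=]; last first.
      by rewrite subset0 andb_idl // => /eqP ->; rewrite inE flat0.
    by rewrite mobius_refl subnn expr0 scale1r mul1r.
  rewrite addrAC subrr add0r.
  apply: eq_bigr => F /andP[]; rewrite inE => flF F0.
  by rewrite mulrA redcharpoly_restrict.
have -> : \sum_(F in flats M) charpoly (restrict M F) * hilb M F = 'X * hilb M set0.
  transitivity (\sum_(F in flats M) \sum_(G in flats M | G \subset F)
      mobius M set0 G *: ('X^(rk F - rk G) * hilb M F)).
    apply: eq_bigr => F; rewrite inE => flF; rewrite restrict_charpoly // mulr_suml.
    by apply: eq_bigr => G _; rewrite scalerAl.
  rewrite (exchange_big_dep (mem (flats M))) /=; last by move=> F G _ /andP[].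
  transitivity (\sum_(G in flats M) (\sum_(F in flats M | G \subset F)
      'X * (mobius M set0 G *: hilb M F) - mobius M set0 G *: ('X - 1))).
    apply: eq_bigr => G flG; have /sum_hilb E1 : is_flat M G by move: flG; rewrite inE.
    rewrite -scaler_sumr; under eq_bigl do rewrite flG /=.
    rewrite E1 scalerBr; congr (_ - _); rewrite -mulr_sumr -scaler_sumr.
    by rewrite scalerAr.
  rewrite sumrB (exchange_big_dep (mem (flats M))) /=; last by move=> F G _ /andP[].
  rewrite -scaler_suml.
  (* The constants x - 1 coming from [sum_hilb] cancel because the ground set is nonempty. *)
  have -> : \sum_(G in flats M) mobius M set0 G = 0.
    transitivity (\sum_(G in flats M | G \subset E) mobius M set0 G).
      by apply: eq_bigl => G; rewrite inE; apply/esym/andb_idr/flat_sub.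
    by rewrite sum_mobius ?flat_ground // (negbTE E0).
  rewrite scale0r subr0 (bigD1 set0) /=; last by rewrite inE flat0.
  (* With the sums exchanged back, the Moebius sum over flats inside F leaves only the empty
     flat. *)
  have inner F : F \in flats M ->
      \sum_(G in flats M | (F \in flats M) && (G \subset F)) 'X * (mobius M set0 G *: hilb M F) =
      (F == set0)%:R *: ('X * hilb M F).
    move=> flF; under eq_bigl do rewrite flF.
    rewrite -mulr_sumr -scaler_suml; move: flF; rewrite inE => /sum_mobius ->.
    by rewrite scalerAr.
  rewrite inner ?inE ?flat0 // eqxx scale1r big1 ?addr0 // => F /andP[flF F0].
  by rewrite inner // (negbTE F0) scale0r.
by rewrite mulrBl mul1r.
Qed.

End ChowPolynomial.

Lemma chowpoly_contract (T : finType) (M : matroid T) F :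
  loopless M -> is_flat M F -> chowpoly (contract M F) = hilb M F.
Proof.
move=> HM flF; rewrite (chowpolyE (contract_loopless HM flF)).
by rewrite -(hilb_contract HM flF flF (subxx _)) setDv.
Qed.

Lemma rank_contract (T : finType) (M : matroid T) F :
  loopless M -> is_flat M F -> F != set0 -> (rank (contract M F) < rank M)%N.
Proof.
move=> HM flF F0; have HM1 := proj1 HM; have FE := flat_sub flF.
rewrite /rank /= setUC setDE setUIr setUCr setIT (setUidPr FE).
have : (0 < rk M F)%N.
  by rewrite -[X in (X < _)%N](rk0 HM1) (flat_rk_lt HM1 (flat0 HM)) // proper0.
by have := rkS HM1 FE (subxx _); lia.
Qed.

Lemma chowpoly_rec (T : finType) (M : matroid T) : loopless M -> ground M != set0 ->
  chowpoly M = \sum_(F in flats M | F != set0)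
    redcharpoly (restrict M F) * chowpoly (contract M F).
Proof.
move=> HM E0; rewrite (chowpolyE HM) (hilb_redcharpoly HM E0).
apply: eq_bigr => F /andP[]; rewrite inE => flF _.
by rewrite chowpoly_contract.
Qed.

(** Reconciles the base case by rank with the recursion, which is stated for a nonempty ground
    set. *)
Lemma rank0_ground (T : finType) (M : matroid T) :
  loopless M -> (rank M == 0%N) = (ground M == set0).
Proof.
move=> [HM1 lp]; apply/eqP/eqP => [r0|E0]; last by rewrite /rank E0 rk0.
apply/eqP; rewrite -subset0; apply/subsetP => x xE.
have := rkS HM1 (_ : [set x] \subset ground M) (subxx _).
by rewrite sub1set -/(rank M) r0 lp // => /(_ xE).
Qed.

Lemma chowpoly_rank0 (T : finType) (M : matroid T) :
  loopless M -> rank M = 0%N -> chowpoly M = 1.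
Proof.
move=> HM /eqP; rewrite (rank0_ground HM) => /eqP E0; rewrite (chowpolyE HM) hilb_rec.
rewrite big1 ?addr0 // => G /andP[]; rewrite inE => /flat_sub.
by rewrite E0 subset0 => /eqP ->; rewrite properxx.
Qed.

Theorem theorem1p4 (T : finType) :
  (* the truncation in the definition of chowpoly is harmless *)
  (forall M : matroid T, loopless M ->
     forall j : nat, (rank M < j)%N -> chow_dim M j = 0%N) /\
  (* the recursion *)
  (forall M : matroid T, loopless M -> ground M != set0 ->
     chowpoly M =
       \sum_(F in flats M | F != set0)
          redcharpoly (restrict M F) * chowpoly (contract M F)) /\
  (* chowpoly satisfies the initial condition *)
  (forall M : matroid T, loopless M -> rank M = 0%N -> chowpoly M = 1) /\
  (* uniqueness *)
  (forall h : matroid T -> {poly int},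
     (forall M : matroid T, loopless M -> rank M = 0%N -> h M = 1) ->
     (forall M : matroid T, loopless M -> rank M <> 0%N ->
        h M = \sum_(F in flats M | F != set0)
                 redcharpoly (restrict M F) * h (contract M F)) ->
     forall M : matroid T, loopless M -> h M = chowpoly M).
Proof.
split; first exact: chow_dim_gt_rank.
split; first exact: chowpoly_rec.
split; first exact: chowpoly_rank0.
(* Uniqueness by induction on the rank: contracting a nonempty flat keeps the matroid loopless and
   lowers its rank. *)
move=> h h0 hrec M; have [n] := ubnP (rank M); elim: n M => // n IH M Mn HM.
have [r0|r0] := eqVneq (rank M) 0%N; first by rewrite h0 // chowpoly_rank0.
rewrite (hrec _ HM (elimN eqP r0)) chowpoly_rec -?rank0_ground //.
apply: eq_bigr => F /andP[]; rewrite inE => flF F0; rewrite IH //.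
  exact: leq_trans (rank_contract HM flF F0) _.
exact: contract_loopless.
Qed.
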